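(* The group $\mathcal A(\mathbb Z)$ has the following properties: (1) the additive group $\mathbb Q$ of rational numbers embeds as a subgroup of $\mathcal A(\mathbb Z)$; (2) $\mathcal A(\mathbb Z)$ has no infinite cyclic quotient (i.e. it is not indicable); (3) $\mathcal A(\mathbb Z)$ is locally free (every finitely generated subgroup is free).
   Context: For a sequence of groups $(G_n)_{n\in\mathbb N}$, an infinite word is a map $w:L\to\bigsqcup_n (G_n\setminus\{1\})$ (disjoint union) from a countable linearly ordered set $L$ such that $w^{-1}(G_n)$ is finite for every $n$. For each $m$, the projection $p_m(w)\in G_1*\cdots*G_m$ is the element represented by the finite word obtained by restricting $w$ to the letters lying in $G_1\cup\dots\cup G_m$. Two infinite words are equivalent if all their projections agree. The topologist's product $\circledast_n G_n$ is the group of equivalence classes, with multiplication induced by concatenation and inversion by reversing the order and inverting each letter. The free product $*_n G_n$ is the subgroup of classes of finite words. The archipelago group is $\mathcal A(G_n):=\circledast_n G_n/\langle\langle *_n G_n\rangle\rangle$ (quotient by the normal closure). $\mathcal A(\mathbb Z)$ denotes the archipelago group of the constant sequence $G_n=\mathbb Z$ for all $n$ (it is the fundamental group of the harmonic archipelago). *)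

(* Defs.v *)
From Stdlib Require Import ZArith List Sorted.

Import ListNotations.

(** * Infinite words over the constant sequence G_n = Z (n : nat, 0-based).
    A letter is a pair (n, z) : nat * Z meaning the element z of the n-th
    copy of Z; it must be non-identity (z <> 0). *)

Record rawword : Type := RawWord {
  carrier : Type;
  wlt : carrier -> carrier -> Prop;
  letter : carrier -> nat * Z
}.

Definition IsWord (w : rawword) : Prop :=
  (forall i, ~ wlt w i i) /\
  (forall i j k, wlt w i j -> wlt w j k -> wlt w i k) /\
  (forall i j, wlt w i j \/ i = j \/ wlt w j i) /\
  (exists f : carrier w -> nat, forall i j, f i = f j -> i = j) /\
  (forall i, snd (letter w i) <> 0%Z) /\
  (forall n, exists l : list (carrier w),
      forall i, fst (letter w i) = n -> In i l).

(** Free product Z * ... * Z: normal form of a finite word (list of letters)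
    by stack reduction (merge adjacent letters of the same factor, drop 1). *)
Definition push (a : nat * Z) (r : list (nat * Z)) : list (nat * Z) :=
  match r with
  | (n', z') :: r' =>
      if Nat.eqb (fst a) n' then
        let s := (snd a + z')%Z in
        if Z.eqb s 0 then r' else (n', s) :: r'
      else a :: r
  | [] => [a]
  end.

Definition reduce (l : list (nat * Z)) : list (nat * Z) := fold_right push [] l.

Definition Enum (w : rawword) (m : nat) (s : list (carrier w)) : Prop :=
  Sorted (wlt w) s /\ (forall i, In i s <-> Nat.lt (fst (letter w i)) m).

(** p_m(w) is the free-product element with normal form
    [reduce (map (letter w) s)] for the enumeration [s]. Two words are
    equivalent iff all projections agree. *)
Definition wequiv (w v : rawword) : Prop :=
  forall m s t, Enum w m s -> Enum v m t ->
    reduce (map (letter w) s) = reduce (map (letter v) t).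

Definition sum_lt {A B : Type} (ra : A -> A -> Prop) (rb : B -> B -> Prop)
  (x y : A + B) : Prop :=
  match x, y with
  | inl a, inl a' => ra a a'
  | inr b, inr b' => rb b b'
  | inl _, inr _ => True
  | inr _, inl _ => False
  end.

Definition wconcat (w v : rawword) : rawword :=
  RawWord (carrier w + carrier v) (sum_lt (wlt w) (wlt v))
    (fun x => match x with inl a => letter w a | inr b => letter v b end).

Definition winv (w : rawword) : rawword :=
  RawWord (carrier w) (fun i j => wlt w j i)
    (fun i => (fst (letter w i), (- snd (letter w i))%Z)).

Definition wempty : rawword :=
  RawWord Empty_set (fun _ _ => False) (fun e => match e with end).

(** Finite words (representatives of elements of the free product). *)
Definition FiniteWord (w : rawword) : Prop :=
  exists l : list (carrier w), forall i, In i l.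

(** Normal closure of the free product in the topologist's product
    (as a set of words, closed under the word equivalence). *)
Inductive InN : rawword -> Prop :=
  | InN_fin : forall x, IsWord x -> FiniteWord x -> InN x
  | InN_equiv : forall x y, InN x -> IsWord y -> wequiv x y -> InN y
  | InN_mul : forall x y, InN x -> InN y -> InN (wconcat x y)
  | InN_inv : forall x, InN x -> InN (winv x)
  | InN_conj : forall u x, IsWord u -> InN x -> InN (wconcat (wconcat u x) (winv u)).

(** Equality in the archipelago group A(Z) = ⊛ Z / <<* Z>>. *)
Definition aeq (x y : rawword) : Prop := InN (wconcat x (winv y)).

Inductive Gen (P : rawword -> Prop) : rawword -> Prop :=
  | Gen_base : forall x, P x -> Gen P x
  | Gen_one : Gen P wempty
  | Gen_inv : forall x, Gen P x -> Gen P (winv x)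
  | Gen_mul : forall x y, Gen P x -> Gen P y -> Gen P (wconcat x y)
  | Gen_equiv : forall x y, Gen P x -> IsWord y -> aeq x y -> Gen P y.

Definition sgen (p : rawword * bool) : rawword :=
  if snd p then fst p else winv (fst p).

Definition eval_basis_word (l : list (rawword * bool)) : rawword :=
  fold_right (fun p acc => wconcat (sgen p) acc) wempty l.

Fixpoint reduced_bw (l : list (rawword * bool)) : Prop :=
  match l with
  | (x, e) :: (((y, e') :: _) as tl) =>
      ~ (aeq x y /\ e' = negb e) /\ reduced_bw tl
  | _ => True
  end.

Definition FreeSubgroup (H : rawword -> Prop) : Prop :=
  exists B : rawword -> Prop,
    (forall b, B b -> IsWord b /\ H b) /\
    (forall x, H x -> Gen B x) /\
    (forall l, l <> [] -> (forall p, In p l -> B (fst p)) -> reduced_bw l ->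
        ~ aeq (eval_basis_word l) wempty).

(* Main.v *)
(** The kernel of the projection of [⊛ Z] onto [A(Z)] consists of the words that
    become trivial once their letters of index [< m] are deleted, for some [m];
    hence [A(Z)] is the direct limit over [m] of the subgroups of words with
    letters of index [>= m], each of which embeds in an inverse limit of free groups.

    Local freeness.  For words [g_1, ..., g_r], the kernel of [F_r -> A(Z)] is
    [U_m ∩_k ker (F_r -> F_(m,k))] with all [F_(m,k)] free.  By Nielsen-Schreier each
    image is free of rank [<= r]; the rank is monotone in the kernel, and two nested
    kernels with equal ranks agree, since both images then have [n!^rank]
    homomorphisms to [S_n] for every [n] and free groups are residually finite.
    Hence both the decreasing and the increasing chains of kernels stabilise, and the
    kernel is that of a single homomorphism [F_r -> F_(m,k)].

    Rational subgroup and indicability.  Both use infinite words with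
    [y n = x n * (y n.+1) ^ (mult n)].  With [x n] a single letter, which dies in
    [A(Z)], the [y n] generate a copy of [Q]; exponent sums show that it is faithful. *)

Require Import Defs.
From Stdlib Require Import ZArith List Sorted.
From mathcomp Require Import all_boot all_algebra.
From Stdlib Require Import Setoid Morphisms.
From mathcomp Require Import all_fingroup boolp zify ring.

Set Implicit Arguments.
Unset Strict Implicit.
Unset Printing Implicit Defensive.

(* The delimiter %Z denotes the scope of MathComp's [int]. *)
Delimit Scope Z_scope with coqZ.

(** * Free reduction *)

(** The letter [(x, true)] stands for the generator [x], and [(x, false)] for its inverse. *)
Definition linv (T : Type) (a : T * bool) : T * bool := (a.1, ~~ a.2).
Definition finv (T : Type) (u : seq (T * bool)) := rev (map (@linv T) u).

Definition fpush (T : eqType) (a : T * bool) (r : seq (T * bool)) :=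
  if r is c :: r' then if c == linv a then r' else a :: r else [:: a].
Definition fred (T : eqType) (u : seq (T * bool)) := foldr (@fpush T) [::] u.
Definition freduced (T : eqType) (u : seq (T * bool)) : bool :=
  sorted (fun a c => c != linv a) u.
Definition feq (T : eqType) (u v : seq (T * bool)) : Prop := fred u = fred v.
Notation "u ≈ v" := (feq u v) (at level 70).

(** [fsub f] is the homomorphism of free groups extending [f], computed on unreduced words. *)
Definition lsub (T U : Type) (f : T -> seq (U * bool)) (a : T * bool) :=
  if a.2 then f a.1 else finv (f a.1).
Definition fsub (T U : Type) (f : T -> seq (U * bool)) (u : seq (T * bool)) :=
  flatten (map (lsub f) u).

Lemma linvK (T : Type) : involutive (@linv T).
Proof. by case=> x b; rewrite /linv /= negbK. Qed.

Lemma finvK (T : Type) : involutive (@finv T).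
Proof.
by move=> u; rewrite /finv map_rev revK -map_comp (eq_map (@linvK T)) map_id.
Qed.

Lemma finv_cat (T : Type) (u v : seq (T * bool)) : finv (u ++ v) = finv v ++ finv u.
Proof. by rewrite /finv map_cat rev_cat. Qed.

Lemma finv_cons (T : Type) a (u : seq (T * bool)) :
  finv (a :: u) = finv u ++ [:: linv a].
Proof. by rewrite -cat1s finv_cat. Qed.

Lemma fsub_cat (T U : Type) (f : T -> seq (U * bool)) u v :
  fsub f (u ++ v) = fsub f u ++ fsub f v.
Proof. by rewrite /fsub map_cat flatten_cat. Qed.

Lemma fsub_cons (T U : Type) (f : T -> seq (U * bool)) a u :
  fsub f (a :: u) = lsub f a ++ fsub f u.
Proof. by []. Qed.

Lemma fsub1 (T U : Type) (f : T -> seq (U * bool)) a : fsub f [:: a] = lsub f a.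
Proof. by rewrite /fsub /= cats0. Qed.

Lemma lsub_linv (T U : Type) (f : T -> seq (U * bool)) a :
  lsub f (linv a) = finv (lsub f a).
Proof. by case: a => x [] //=; rewrite /lsub /= finvK. Qed.

Lemma fsub_finv (T U : Type) (f : T -> seq (U * bool)) u :
  fsub f (finv u) = finv (fsub f u).
Proof.
elim: u => // a u IH.
by rewrite finv_cons fsub_cat IH fsub1 lsub_linv fsub_cons finv_cat.
Qed.

Lemma fsub_comp (T U V : Type) (f : T -> seq (U * bool)) (g : U -> seq (V * bool)) u :
  fsub g (fsub f u) = fsub (fun x => fsub g (f x)) u.
Proof.
elim: u => // a u IH; rewrite !fsub_cons fsub_cat IH; congr (_ ++ _).
by rewrite /lsub; case: a.2; rewrite ?fsub_finv.
Qed.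

Lemma eq_fsub (T U : Type) (f g : T -> seq (U * bool)) : f =1 g -> fsub f =1 fsub g.
Proof. by move=> fg u; congr flatten; apply: eq_map => a; rewrite /lsub fg. Qed.

Lemma freduced_push (T : eqType) (a : T * bool) r : freduced r -> freduced (fpush a r).
Proof.
case: r => //= c r; case: eqP => [_|/eqP ca] /=; first exact: path_sorted.
by move=> ->; rewrite ca.
Qed.

Lemma fpushK (T : eqType) (a : T * bool) r : freduced r -> fpush a (fpush (linv a) r) = r.
Proof.
case: r => [|c r] /=; first by rewrite eqxx.
rewrite linvK; case: (eqVneq c a) => [->|ca] /=; last by rewrite eqxx.
by case: r => //= d r /andP[/negPf ->].
Qed.

Lemma freduced_fred (T : eqType) (u : seq (T * bool)) : freduced (fred u).
Proof. by elim: u => //= a u IH; apply: freduced_push. Qed.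

(* An action of the letters in which opposite letters act inversely factors
   through free reduction. *)
Lemma foldr_fred (T : eqType) (S : Type) (g : T * bool -> S -> S) (P : S -> Prop) :
  (forall a s, P s -> P (g a s)) ->
  (forall a s, P s -> g a (g (linv a) s) = s) ->
  forall u s, P s -> foldr g s (fred u) = foldr g s u.
Proof.
move=> gP gK u s Ps.
have foldP v : P (foldr g s v) by elim: v => //= a v; apply: gP.
elim: u => //= a u <-; case: (fred u) => //= c r.
by case: eqP => //= ->; rewrite gK.
Qed.

Lemma fred_cat (T : eqType) (u v : seq (T * bool)) :
  fred (u ++ v) = foldr (@fpush T) (fred v) u.
Proof. by rewrite /fred foldr_cat. Qed.

Lemma fred_id (T : eqType) (u : seq (T * bool)) : freduced u -> fred u = u.
Proof.
elim: u => //= a u IH ru; rewrite IH; last exact: path_sorted ru.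
by case: u ru {IH} => //= c u /andP[/negPf ->].
Qed.

#[global] Instance feq_equiv (T : eqType) : Equivalence (@feq T).
Proof. by split=> [u|u v|u v w]; rewrite /feq // => ->. Qed.

Lemma feq_fred (T : eqType) (u : seq (T * bool)) : fred u ≈ u.
Proof. exact/fred_id/freduced_fred. Qed.

(** Left multiplication by [u] acts on reduced words through [fpush], and this action depends only
    on [fred u]. *)
Lemma feq_cat (T : eqType) (u u' v v' : seq (T * bool)) :
  u ≈ u' -> v ≈ v' -> u ++ v ≈ u' ++ v'.
Proof.
move=> uu' vv'; rewrite /feq !fred_cat vv'.
have E w : foldr (@fpush T) (fred v') w = foldr (@fpush T) (fred v') (fred w).
  rewrite (@foldr_fred _ _ (@fpush T) (@freduced T)) //.
  - by move=> a s; apply: freduced_push.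
  - by move=> a s; apply: fpushK.
  - exact: freduced_fred.
by rewrite E uu' -E.
Qed.

#[global] Instance cat_feq (T : eqType) : Proper (@feq T ==> @feq T ==> @feq T) cat.
Proof. by move=> u u' uu' v v' vv'; apply: feq_cat. Qed.

#[global] Instance cons_feq (T : eqType) a : Proper (@feq T ==> @feq T) (cons a).
Proof. by move=> u v uv; apply: (@feq_cat _ [:: a] [:: a] u v). Qed.

Lemma feq_cancel2 (T : eqType) a (u : seq (T * bool)) : [:: a, linv a & u] ≈ u.
Proof. by rewrite /feq /= fpushK // freduced_fred. Qed.

Lemma feq_catV (T : eqType) (u : seq (T * bool)) : u ++ finv u ≈ [::].
Proof.
elim: u => // a u IH; rewrite finv_cons catA -(cat1s a) -(catA [:: a]) IH /=.
exact: feq_cancel2.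
Qed.

Lemma feq_Vcat (T : eqType) (u : seq (T * bool)) : finv u ++ u ≈ [::].
Proof. by rewrite -{2}(finvK u); apply: feq_catV. Qed.

Lemma feq_catVP (T : eqType) (u v : seq (T * bool)) : u ≈ v <-> u ++ finv v ≈ [::].
Proof.
split=> [->|E]; first exact: feq_catV.
have : (u ++ finv v) ++ v ≈ v by rewrite E.
by rewrite -catA feq_Vcat cats0.
Qed.

#[global] Instance finv_feq (T : eqType) : Proper (@feq T ==> @feq T) (@finv T).
Proof.
move=> u v uv; apply/feq_catVP; rewrite finvK -uv; exact: feq_Vcat.
Qed.

(** The letter [a] acts on reduced words by left multiplication by [lsub f a]. Opposite letters act
    inversely, so the action factors through free reduction. *)
Lemma fsub_feq (T U : eqType) (f : T -> seq (U * bool)) u v :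
  u ≈ v -> fsub f u ≈ fsub f v.
Proof.
pose g a s := fred (lsub f a ++ s).
have E w : fred (fsub f w) = foldr g [::] w.
  elim: w => //= a w IH; rewrite fsub_cons /g -IH.
  exact: (feq_cat (erefl _) (esym (feq_fred _))).
have gP : forall a s, freduced s -> freduced (g a s) by move=> *; apply: freduced_fred.
have gK a s : freduced s -> g a (g (linv a) s) = s.
  move=> rs; rewrite /g -[RHS]fred_id //.
  change (lsub f a ++ fred (lsub f (linv a) ++ s) ≈ s).
  by rewrite feq_fred catA lsub_linv feq_catV.
have H w : foldr g [::] w = foldr g [::] (fred w) by rewrite (foldr_fred gP gK).
by rewrite /feq !E H => ->; rewrite -H.
Qed.

#[global] Instance fsub_proper (T U : eqType) (f : T -> seq (U * bool)) :
  Proper (@feq T ==> @feq U) (fsub f).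
Proof. by move=> u v; apply: fsub_feq. Qed.

Lemma fsub_feqf (T : Type) (U : eqType) (f g : T -> seq (U * bool)) u :
  (forall x, f x ≈ g x) -> fsub f u ≈ fsub g u.
Proof.
move=> fg; elim: u => // a u IH; rewrite !fsub_cons IH.
by apply: feq_cat => //; rewrite /lsub; case: a.2; rewrite ?fg.
Qed.

(** Deleting the letters over some generators is the substitution that sends these generators to the
    empty word. *)
Lemma feq_filter (T : eqType) (p : pred T) (u v : seq (T * bool)) :
  u ≈ v -> [seq a <- u | p a.1] ≈ [seq a <- v | p a.1].
Proof.
pose f x := if p x then [:: (x, true)] else [::].
have E w : [seq a <- w | p a.1] = fsub f w.
  elim: w => //= -[x b] w ->; rewrite fsub_cons /lsub /f /=.
  by case: (p x); case: b.
by rewrite !E; apply: fsub_feq.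
Qed.

Lemma feq_map_inj (T U : eqType) (h : T -> U) (u : seq (T * bool)) :
  injective h -> map (fun a => (h a.1, a.2)) u ≈ [::] -> u ≈ [::].
Proof.
move=> h_inj; rewrite /feq.
have -> : fred (map (fun a => (h a.1, a.2)) u) = map (fun a => (h a.1, a.2)) (fred u).
  elim: u => //= a u ->; case: (fred u) => //= c r.
  have -> : ((h c.1, c.2) == linv (h a.1, a.2)) = (c == linv a).
    by case: c a => [x b] [y d]; rewrite /linv /= !xpair_eqE (inj_eq h_inj).
  by case: ifP.
by case: (fred u).
Qed.

(** * Evaluation in finite groups and residual finiteness of free groups *)

Section Evaluation.
Local Open Scope group_scope.

Definition fev (T : Type) (G : finGroupType) (s : T -> G) (u : seq (T * bool)) : G :=
  foldr (fun a g => (if a.2 then s a.1 else (s a.1)^-1) * g) 1 u.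

Lemma fev_feq (T : eqType) (G : finGroupType) (s : T -> G) u v :
  u ≈ v -> fev s u = fev s v.
Proof.
move=> uv.
have H w : fev s w = fev s (fred w).
  rewrite /fev (@foldr_fred _ _ _ (fun=> True)) //.
  by case=> x [] g _ /=; rewrite ?mulKVg ?mulKg.
by rewrite H uv -H.
Qed.

Lemma fev_cat (T : Type) (G : finGroupType) (s : T -> G) u v :
  fev s (u ++ v) = fev s u * fev s v.
Proof. by elim: u => [|a u /= ->]; rewrite ?mul1g ?mulgA. Qed.

Lemma fev_finv (T : Type) (G : finGroupType) (s : T -> G) u :
  fev s (finv u) = (fev s u)^-1.
Proof.
elim: u => [|[x b] u IH]; rewrite ?invg1 //= finv_cons fev_cat IH /= mulg1 invMg.
by case: b; rewrite ?invgK.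
Qed.

Lemma fev_fsub (T U : Type) (G : finGroupType) (f : T -> seq (U * bool)) (s : U -> G) u :
  fev s (fsub f u) = fev (fun x => fev s (f x)) u.
Proof.
elim: u => // a u IH; rewrite fsub_cons fev_cat IH /=; congr (_ * _).
by rewrite /lsub; case: a.2; rewrite ?fev_finv.
Qed.

Lemma eq_fev (T : Type) (G : finGroupType) (s t : T -> G) : s =1 t -> fev s =1 fev t.
Proof. by move=> st u; elim: u => //= a u ->; rewrite st. Qed.

Lemma fev_letter (T : Type) (G : finGroupType) (s : T -> G) x : fev s [:: (x, true)] = s x.
Proof. by rewrite /= mulg1. Qed.

(** The partial injection is extended pair by pair: composing with the transposition of [p x] and
    [y] repairs the value at [x] and keeps the other prescribed values, which differ from both
    points. *)
Lemma perm_extend (S : finType) (L : seq (S * S)) :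
  uniq (unzip1 L) -> uniq (unzip2 L) ->
  exists p : {perm S}, forall e, e \in L -> p e.1 = e.2.
Proof.
elim: L => [|[x y] L IH] /=; first by exists 1.
move=> /andP[xL u1] /andP[yL u2]; have [p pL] := IH u1 u2.
exists (p * tperm (p x) y) => e; rewrite inE permM => /orP[/eqP -> /=|eL].
  by rewrite tpermL.
rewrite pL // tpermD //; last by apply: contraNneq yL => ->; apply: map_f.
apply: contraNneq xL => exy; have -> : x = e.1 by apply: (@perm_inj _ p); rewrite pL.
exact: map_f.
Qed.

(** Let n be the length of the reduced form. Its generators are made to act on the points 0, ..., n
    so that the i-th letter moves i to i + 1; the whole word then moves 0 to n, which is not 0. *)
Lemma residually_finite (T : eqType) (u : seq (T * bool)) :
  ~ u ≈ [::] -> exists n (s : T -> 'S_n), fev s u != 1.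
Proof.
move=> uN1; have wr := freduced_fred u.
rewrite /feq /= in uN1; set w := fred u in wr uN1.
have wN0 : 0 < size w by case: w uN1 {wr} => // /(_ erefl).
case E : w wN0 => [//|a0 w'] _.
pose n := size w.
have key x : exists p : 'S_n.+1, forall i, i < n -> (nth a0 w i).1 = x ->
    if (nth a0 w i).2 then p (inord i) = inord i.+1 else p (inord i.+1) = inord i.
  pose Lx := [seq (if (nth a0 w i).2 then (inord i, inord i.+1)
                   else (inord i.+1, inord i) : 'I_n.+1 * 'I_n.+1)
             | i <- iota 0 n & (nth a0 w i).1 == x].
  have adj i : i.+1 < n -> nth a0 w i.+1 != linv (nth a0 w i).
    by move=> lt; move/(sortedP a0): wr => /(_ i lt).
  have inord_eq i j : i <= n -> j <= n -> (inord i == inord j :> 'I_n.+1) = (i == j).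
    by move=> li lj; rewrite -val_eqE /= !inordK.
  have opp i : i.+1 < n -> (nth a0 w i).1 = x -> (nth a0 w i.+1).1 = x ->
      (nth a0 w i).2 = (nth a0 w i.+1).2.
    move=> lt e1 e2; have := adj i lt; rewrite /linv.
    case: (nth a0 w i) e1 => [y b] /= ->; case: (nth a0 w i.+1) e2 => [z d] /= ->.
    by rewrite xpair_eqE eqxx; case: b; case: d.
  have inj1 i j : i < n -> j < n -> (nth a0 w i).1 = x -> (nth a0 w j).1 = x ->
      ((if (nth a0 w i).2 then i else i.+1) = (if (nth a0 w j).2 then j else j.+1) -> i = j)
      /\ ((if (nth a0 w i).2 then i.+1 else i) = (if (nth a0 w j).2 then j.+1 else j) -> i = j).
    move=> li lj ei ej; split.
    - case bi: (nth a0 w i).2; case bj: (nth a0 w j).2 => //.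
      + by move=> h; subst i; have := opp j li ej ei; rewrite bi bj.
      + by move=> h; subst j; have := opp i lj ei ej; rewrite bi bj.
      + by case.
    - case bi: (nth a0 w i).2; case bj: (nth a0 w j).2 => //.
      + by case.
      + by move=> h; subst j; have := opp i lj ei ej; rewrite bi bj.
      + by move=> h; subst i; have := opp j li ej ei; rewrite bi bj.
  have [||p pL] := @perm_extend _ Lx.
  - rewrite /unzip1 -map_comp map_inj_in_uniq ?filter_uniq ?iota_uniq // => i j.
    rewrite !mem_filter !mem_iota /= !add0n => /andP[/eqP ei li] /andP[/eqP ej lj].
    have [h _] := inj1 i j li lj ei ej.
    by case bi: (nth a0 w i).2 h; case bj: (nth a0 w j).2 => /= h /eqP;
      rewrite inord_eq ?(ltnW li, ltnW lj) // => /eqP.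
  - rewrite /unzip2 -map_comp map_inj_in_uniq ?filter_uniq ?iota_uniq // => i j.
    rewrite !mem_filter !mem_iota /= !add0n => /andP[/eqP ei li] /andP[/eqP ej lj].
    have [_ h] := inj1 i j li lj ei ej.
    by case bi: (nth a0 w i).2 h; case bj: (nth a0 w j).2 => /= h /eqP;
      rewrite inord_eq ?(ltnW li, ltnW lj) // => /eqP.
  exists p => i li ei.
  have iL : (if (nth a0 w i).2 then (inord i, inord i.+1)
                   else (inord i.+1, inord i) : 'I_n.+1 * 'I_n.+1) \in Lx.
    by apply/mapP; exists i; rewrite // mem_filter mem_iota ei eqxx /=.
  by have := pL _ iL; case: (nth a0 w i).2.
have [s sP] := choice key.
exists n.+1, s; rewrite (@fev_feq _ _ s u w) //; last exact/esym/feq_fred.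
suff H : forall k i, k + i = n -> fev s (drop i w) (inord i) = inord n.
  have := H n 0; rewrite addn0 drop0 => /(_ erefl) Hw; apply/eqP => w1.
  move: Hw; rewrite w1 perm1 => /(congr1 (@nat_of_ord _)); rewrite !inordK //.
  by rewrite /n E.
elim=> [|k IH] i; first by rewrite add0n => ->; rewrite drop_oversize //= perm1.
rewrite addSnnS => ki; have li : i < n by rewrite -ki addnS ltnS leq_addl.
rewrite (drop_nth a0) //= permM -(IH _ ki); congr (fun_of_perm _ _).
have := sP _ i li erefl; case: (nth a0 w i).2 => // <-.
by rewrite permK.
Qed.

End Evaluation.

(** * Subgroups of free groups and their ranks *)

(** The words [v i] map to a free basis of the image of [fsub f]; the basis is recorded through
    preimages over [T]. *)
Definition fbasis (T : Type) (U I : eqType) (f : T -> seq (U * bool))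
    (v : I -> seq (T * bool)) : Prop :=
  (forall u, fsub f (fsub v u) ≈ [::] -> u ≈ [::]) /\
  (forall x, exists u, f x ≈ fsub f (fsub v u)).

(** * The Nielsen-Schreier theorem for the image of a finitely generated free group *)

Section NielsenSchreier.
Variables (T : finType) (U : choiceType) (f : T -> seq (U * bool)).
Implicit Types (t u v p : seq (U * bool)) (a : U * bool).

(** [K] is the image subgroup; its right cosets are the vertices of the coset graph. *)
Let K u := exists w, fsub f w ≈ u.
Let coset u v := K (u ++ finv v).

Let K_feq u v : u ≈ v -> K u -> K v.
Proof. by move=> uv [w wu]; exists w; rewrite wu. Qed.

Let K1 : K [::]. Proof. by exists [::]. Qed.

Let KM u v : K u -> K v -> K (u ++ v).
Proof. by move=> [w wu] [w' wv]; exists (w ++ w'); rewrite fsub_cat wu wv. Qed.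

Let KV u : K u -> K (finv u).
Proof. by move=> [w wu]; exists (finv w); rewrite fsub_finv wu. Qed.

Let cosetxx u : coset u u.
Proof. by apply: K_feq K1; rewrite feq_catV. Qed.

Let coset_sym u v : coset u v -> coset v u.
Proof. by move/KV; rewrite finv_cat finvK. Qed.

Let coset_trans v u w : coset u v -> coset v w -> coset u w.
Proof.
move=> uv /(KM uv); apply: K_feq.
by rewrite -catA (catA (finv v)) feq_Vcat.
Qed.

Let coset_cat u v w : coset u v -> coset (u ++ w) (v ++ w).
Proof. by apply: K_feq; rewrite finv_cat -catA (catA w) feq_catV. Qed.

Let coset_feq u v : u ≈ v -> coset u v.
Proof. by move=> uv; apply: K_feq K1; rewrite uv feq_catV. Qed.

Let coset1 u : K u -> coset u [::].
Proof. by rewrite /coset cats0. Qed.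

Let dist_ex u : exists n, `[< exists v, size v = n /\ coset v u >].
Proof. by exists (size u); apply/asboolP; exists u; split => //; apply: cosetxx. Qed.

Let dist u := ex_minn (dist_ex u).

Let dist_le u v : coset v u -> dist u <= size v.
Proof.
by rewrite /dist; case: ex_minnP => n _ nP vu; apply: nP; apply/asboolP; exists v.
Qed.

Let dist_wit u : exists v, size v = dist u /\ coset v u.
Proof. by rewrite /dist; case: ex_minnP => n /asboolP. Qed.

Let dist_coset u v : coset u v -> dist u = dist v.
Proof.
move=> uv; apply/eqP; rewrite eqn_leq; apply/andP; split.
  have [w [<- wv]] := dist_wit v; apply: dist_le.
  exact: coset_trans wv (coset_sym uv).
by have [w [<- wu]] := dist_wit u; apply: dist_le; apply: coset_trans wu uv.
Qed.

Let parent n u (px : seq (U * bool) * (U * bool)) : Prop :=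
  dist px.1 = n /\ coset (rcons px.1 px.2) u.

Let pickP (P : seq (U * bool) * (U * bool) -> Prop) :=
  if pselect (exists px, P px) is left h then Some (projT1 (cid h)) else None.

(** A Schreier transversal: a coset at distance n + 1 from [K] extends by one letter the
    representative of a chosen neighbour at distance n, so prefixes of representatives are
    representatives. *)
Fixpoint transv n u :=
  if n is n'.+1 then
    if pickP (parent n' u) is Some (p, x) then rcons (transv n' p) x else [::]
  else [::].

(** The choice is made from a predicate which, by extensionality, is the same for all words of a
    coset. *)
Let transv_coset n u v : coset u v -> transv n u = transv n v.
Proof.
case: n => //= n uv; suff -> : parent n u = parent n v by [].
apply: funext => px; apply: propext; split=> -[d c]; split => //.
  exact: coset_trans c uv.
exact: coset_trans c (coset_sym uv).
Qed.

Let transvS n u : dist u = n.+1 -> exists p x,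
  [/\ transv n.+1 u = rcons (transv n p) x, dist p = n & coset (rcons p x) u].
Proof.
move=> du /=; rewrite /pickP; case: pselect => [h|[]]; last first.
  have [v [vn vu]] := dist_wit u; move: vn vu; rewrite du.
  case/lastP: v => // p x; rewrite size_rcons => -[pn] pu; exists (p, x); split=> //=.
  apply/eqP; rewrite eqn_leq -{1}pn (dist_le (cosetxx p)) /=.
  have [q [<- qp]] := dist_wit p; rewrite -ltnS -du.
  have := @dist_le u (rcons q x); rewrite size_rcons; apply.
  by apply: coset_trans pu; rewrite -!cats1; apply: coset_cat.
by case: (cid h) => -[p x] /= [dp pu]; exists p, x.
Qed.

Let transvP n u : dist u = n -> coset (transv n u) u /\ size (transv n u) = n.
Proof.
elim: n u => [|n IH] u du.
  by have [v [+ vu]] := dist_wit u; rewrite du; case: v vu.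
have [p [x [-> dp pu]]] := transvS du; have [cp sp] := IH _ dp.
rewrite size_rcons sp; split=> //; apply: coset_trans pu.
by rewrite -!cats1; apply: coset_cat.
Qed.

Let tau u := transv (dist u) u.

Let tau_coset u : coset (tau u) u.
Proof. by have [] := @transvP (dist u) u. Qed.

Let tau_eq u v : coset u v -> tau u = tau v.
Proof. by move=> uv; rewrite /tau (dist_coset uv); apply: transv_coset. Qed.

Let tauK u : tau (tau u) = tau u.
Proof. exact/tau_eq/tau_coset. Qed.

Let tau1 : tau [::] = [::].
Proof.
have [_] := @transvP (dist [::]) [::] erefl; rewrite -/(tau _).
have := dist_le (cosetxx [::]); rewrite leqn0 => /eqP ->.
by move/size0nil.
Qed.

Let tau_K u : K u -> tau u = [::].
Proof. by move=> Ku; rewrite -tau1; apply/tau_eq/coset1. Qed.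

Let tau_prefix p x : tau (rcons p x) = rcons p x -> tau p = p.
Proof.
move=> E; have [_ sE] := @transvP (dist (rcons p x)) (rcons p x) erefl.
move: sE; rewrite -/(tau _) E size_rcons => /esym du.
have [q [y [E' dq _]]] := transvS du.
move: E; rewrite /tau du E' => /rcons_inj[<- _].
by rewrite -dq; apply: tauK.
Qed.

Let tau_cat u v : tau (tau u ++ v) = tau (u ++ v).
Proof. exact/tau_eq/coset_cat/tau_coset. Qed.

Let tau_back t a : tau t = t -> tau (tau (t ++ [:: a]) ++ [:: linv a]) = t.
Proof.
move=> tt; rewrite tau_cat -[RHS]tt; apply/tau_eq/coset_feq.
by rewrite -catA /= feq_cancel2 cats0.
Qed.

(* An edge [(t, x)] of the coset graph joins the cosets of [t] and [t x]. *)
Let edge : Type := (seq (U * bool) * U)%type.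

(** The spanning tree of the transversal: one end of the edge extends the other by a letter as a
    word, and not only as a coset. *)
Let tree (e : edge) :=
  let t' := tau (e.1 ++ [:: (e.2, true)]) in
  (t' == e.1 ++ [:: (e.2, true)]) || (e.1 == t' ++ [:: (e.2, false)]).

(** The Schreier generator of the edge: out along the tree, across the edge, back along the tree. *)
Let loop (e : edge) :=
  e.1 ++ (e.2, true) :: finv (tau (e.1 ++ [:: (e.2, true)])).

Let sgl (e : edge) : seq (edge * bool) := if tree e then [::] else [:: (e, true)].

(** A negative letter crosses its edge backwards, so that edge starts at the coset being reached. *)
Let step t a :=
  if a.2 then sgl (t, a.1) else finv (sgl (tau (t ++ [:: a]), a.1)).

(* Reidemeister rewriting of a word read from the coset of [t]. *)
Fixpoint rewr t u :=
  if u is a :: u' then step t a ++ rewr (tau (t ++ [:: a])) u' else [::].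

Let rewr_cat t u v : tau t = t -> rewr t (u ++ v) = rewr t u ++ rewr (tau (t ++ u)) v.
Proof.
elim: u t => [|a u IH] t tt /=; first by rewrite cats0 tt.
by rewrite IH ?tauK // tau_cat -!catA.
Qed.

Let rewr_cancel t a u : tau t = t -> rewr t [:: a, linv a & u] ≈ rewr t u.
Proof.
move=> tt /=; rewrite (tau_back _ tt) catA; set c := (X in X ++ _).
suff -> : c ≈ [::] by [].
have := tau_back a tt; rewrite /c /step; case: a {c} => x [] /= E.
  by rewrite E; apply: feq_catV.
exact: feq_Vcat.
Qed.

Let rewr_feq t u v : tau t = t -> u ≈ v -> rewr t u ≈ rewr t v.
Proof.
move=> tt uv; suff E w : rewr t w ≈ rewr t (fred w) by rewrite (E u) uv -E.
elim: w t tt => // a w IH t tt /=; rewrite (IH _ (tauK _)).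
case E: (fred w) => [|c r] //; rewrite -E /fpush E; case: eqP => [->|//].
exact: rewr_cancel.
Qed.

(** A representative is read along tree edges only, because its prefixes are representatives. *)
Let rewr_tau t : tau t = t -> rewr [::] t = [::].
Proof.
elim/last_ind: t => // t a IH E; have tt := tau_prefix E.
rewrite -cats1 rewr_cat // IH //= tt cats0.
move: E; rewrite -cats1 => E; rewrite /step; case: a E => x [] /= E.
  by rewrite /sgl /tree /= E eqxx.
have B : tau (t ++ [:: (x, false)] ++ [:: (x, true)]) = t.
  by have := tau_back (x, false) tt; rewrite tau_cat -catA /linv.
by rewrite E /sgl /tree /= -catA B eqxx orbT.
Qed.

Let loop_tree e : tree e -> loop e ≈ [::].
Proof.
rewrite /loop; case/orP=> /eqP E.
  by rewrite -cat1s catA E feq_catV.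
rewrite {1}E -catA; set t := tau _.
have -> : [:: (e.2, false)] ++ (e.2, true) :: finv t ≈ finv t.
  exact: (feq_cancel2 (e.2, false)).
exact: feq_catV.
Qed.

Let fsub_sgl e : fsub loop (sgl e) ≈ loop e.
Proof. by rewrite /sgl; case: ifP => [/loop_tree ->|_] //; rewrite fsub1. Qed.

Let fsub_step t a : tau t = t ->
  fsub loop (step t a) ++ tau (t ++ [:: a]) ≈ t ++ [:: a].
Proof.
move=> tt; have := tau_back a tt; rewrite /step; case: a => x [] /= B.
  by rewrite fsub_sgl /loop /= -catA cat_cons feq_Vcat.
rewrite fsub_finv fsub_sgl /loop /= B finv_cat finv_cons finvK.
by rewrite -!catA feq_Vcat cats0.
Qed.

(** The loops along the path of [u] telescope: each return along the tree cancels the next way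
    out. *)
Let fsub_rewr t u : tau t = t -> fsub loop (rewr t u) ++ tau (t ++ u) ≈ t ++ u.
Proof.
elim: u t => [|a u IH] t tt /=; first by rewrite cats0 tt.
have := IH _ (tauK (t ++ [:: a])); rewrite tau_cat -catA /= => E.
rewrite fsub_cat -catA E catA fsub_step //.
by rewrite -catA.
Qed.

Let good (e : edge) := ~~ tree e /\ tau e.1 = e.1.

Let K_loop e : K (loop e).
Proof.
rewrite /loop -cat1s catA; exact/coset_sym/tau_coset.
Qed.

Let rewr_loop e : good e -> rewr [::] (loop e) ≈ [:: (e, true)].
Proof.
case: e => t x [/= nt tt]; rewrite /loop /= rewr_cat ?tau1 // rewr_tau //= tt.
have -> : step t (x, true) = [:: ((t, x), true)] by rewrite /step /= /sgl (negPf nt).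
set t' := tau (t ++ _); suff -> : rewr t' (finv t') ≈ [::] by [].
have t't : tau t' = t' by apply: tauK.
rewrite -{1}t't -[rewr _ _]cat0s -[in X in X ++ _](rewr_tau t't) -rewr_cat //.
by rewrite (rewr_feq _ (feq_catV _)).
Qed.

Let rewr_finv u : K u -> rewr [::] (finv u) ≈ finv (rewr [::] u).
Proof.
move=> Ku; have : rewr [::] (u ++ finv u) ≈ [::] by rewrite (rewr_feq _ (feq_catV _)).
rewrite rewr_cat // (tau_K Ku) => E.
have : finv (rewr [::] u) ++ (rewr [::] u ++ rewr [::] (finv u)) ≈ finv (rewr [::] u).
  by rewrite E cats0.
by rewrite catA feq_Vcat.
Qed.

(** Rewriting is a left inverse of [fsub loop], so the loops of non-tree edges are independent. *)
Let rewr_fsub (W : seq (edge * bool)) :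
  (forall c, c \in W -> good c.1) -> rewr [::] (fsub loop W) ≈ W.
Proof.
elim: W => // c W IH gW; rewrite fsub_cons rewr_cat //.
have Kc : K (lsub loop c) by rewrite /lsub; case: c.2; [|apply: KV]; apply: K_loop.
rewrite (tau_K Kc) IH; last by move=> d dW; apply: gW; rewrite inE dW orbT.
have := gW c (mem_head _ _); case: c {gW Kc IH} => e b /= ge.
have -> : rewr [::] (lsub loop (e, b)) ≈ [:: (e, b)]; last by [].
rewrite /lsub; case: b => /=; first exact: rewr_loop.
by rewrite rewr_finv ?rewr_loop //; apply: K_loop.
Qed.

Let rewr_good t u c : tau t = t -> c \in rewr t u -> good c.1.
Proof.
elim: u t => //= a u IH t tt; rewrite mem_cat => /orP[|]; last by apply: IH; apply: tauK.
rewrite /step /sgl; case: a.2; case: ifP => //= /negbT; rewrite inE => nt /eqP ->.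
  by split.
by split=> //=; apply: tauK.
Qed.

(** The basis consists of the loops of the edges met when rewriting the finitely many [f x]:
    [rewr_fsub] makes them independent, and [fsub_rewr] makes them generate. *)
Lemma nielsen_schreier : exists (I : finType) (v : I -> seq (T * bool)), fbasis f v.
Proof.
pose E := flatten [seq map fst (rewr [::] (f x)) | x <- enum T].
have good_E e : e \in E -> good e.
  case/flatten_mapP=> x _ /mapP[c + ->]; exact: rewr_good.
have [v vP] := choice (fun i : seq_sub E => K_loop (val i)).
exists (seq_sub E), v.
have fvE z : fsub f (fsub v z) ≈ fsub loop (map (fun c => (val c.1, c.2)) z).
  rewrite fsub_comp (fsub_feqf _ vP).
  suff -> : map (fun c => (val c.1, c.2)) z =
            fsub (fun i : seq_sub E => [:: (val i, true)]) z.
    by rewrite fsub_comp; apply: fsub_feqf => i; rewrite fsub1.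
  by elim: z => // -[i b] z IH; rewrite fsub_cons -IH; case: b.
split=> [u|x].
  rewrite fvE => /(rewr_feq tau1); rewrite rewr_fsub.
    exact/feq_map_inj/val_inj.
  by move=> c /mapP[[i b] _ ->]; apply: good_E; apply: valP.
have [u uE] : exists u : seq (seq_sub E * bool),
    map (fun c => (val c.1, c.2)) u = rewr [::] (f x).
  have : {subset map fst (rewr [::] (f x)) <= E}.
    by move=> e ex; apply/flatten_mapP; exists x; rewrite ?mem_enum.
  elim: (rewr _ _) => [|[e b] r IH] rE; first by exists [::].
  have [|u uE] := IH; first by move=> d dr; apply: rE; rewrite inE dr orbT.
  by exists ((SeqSub (rE e (mem_head _ _)), b) :: u); rewrite /= uE.
exists u; rewrite fvE uE.
have := fsub_rewr (f x) tau1; rewrite /= tau_K ?cats0 //.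
by exists [:: (x, true)]; rewrite fsub1.
Qed.

End NielsenSchreier.

(** * Ranks and chains of kernels *)

Section Rank.
Variable T : finType.
Implicit Types (U : choiceType).

Definition fker U (f : T -> seq (U * bool)) (w : seq (T * bool)) : Prop := fsub f w ≈ [::].

Lemma fkerP U (f : T -> seq (U * bool)) u w :
  fker f (u ++ finv w) <-> fsub f u ≈ fsub f w.
Proof. by rewrite /fker fsub_cat fsub_finv -feq_catVP. Qed.

(** These are the homomorphisms from the image of [f] to S_n, each recorded by its values on the
    generators [f x]. *)
Definition homs U (f : T -> seq (U * bool)) n : {set {ffun T -> 'S_n}} :=
  [set s : {ffun T -> 'S_n} | `[< forall w, fker f w -> fev s w = 1%g >]].

Lemma homsP U (f : T -> seq (U * bool)) n (s : {ffun T -> 'S_n}) :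
  reflect (forall w, fker f w -> fev s w = 1%g) (s \in homs f n).
Proof. by rewrite inE; apply: asboolP. Qed.

Lemma homs_eq U (f : T -> seq (U * bool)) n (s : {ffun T -> 'S_n}) u w :
  s \in homs f n -> fsub f u ≈ fsub f w -> fev s u = fev s w.
Proof.
move=> /homsP sP /fkerP /sP; rewrite fev_cat fev_finv => E.
by rewrite -[LHS](mulgKV (fev s w)) E mul1g.
Qed.

(** A homomorphism out of a free group amounts to arbitrary values on a basis; [th] turns such
    values into values on [T]. *)
Lemma card_homs_basis U (f : T -> seq (U * bool)) (I : finType) (v : I -> seq (T * bool)) n :
  fbasis f v -> #|homs f n| = n`! ^ #|I|.
Proof.
move=> [v_free v_gen]; have [V VP] := choice v_gen.
pose th (s : {ffun I -> 'S_n}) := [ffun x : T => fev s (V x)].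
have thE s : fev (th s) =1 fun w => fev s (fsub V w).
  by move=> w; rewrite fev_fsub; apply: eq_fev => x; rewrite ffunE.
have fvV w : fsub f (fsub v (fsub V w)) ≈ fsub f w.
  by rewrite !fsub_comp; apply: fsub_feqf => x; rewrite -fsub_comp -VP.
have thv s i : fev (th s) (v i) = s i.
  rewrite thE -(fev_letter s i); apply: fev_feq; apply/feq_catVP.
  apply: v_free; rewrite fsub_cat fsub_cat fvV fsub_finv fsub_finv fsub1.
  exact: feq_catV.
have th_inj : injective th.
  by move=> s s' E; apply/ffunP => i; rewrite -!thv E.
suff -> : homs f n = th @: setT.
  by rewrite card_imset // cardsT card_ffun card_Sn.
apply/setP => s; apply/idP/imsetP => [sP|[s' _ ->]]; last first.
  apply/homsP => w fw; rewrite thE; apply: (@fev_feq _ _ _ _ [::]).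
  by apply: v_free; rewrite fvV.
exists [ffun i => fev s (v i)] => //; apply/ffunP => x; rewrite ffunE.
rewrite -[LHS](fev_letter s x) (eq_fev (ffunE _)) -fev_fsub.
by apply: homs_eq sP _; rewrite fsub1 -VP.
Qed.

(* The rank of the free group [im f], read off from [|Hom(im f, S_2)| = 2 ^ rank]. *)
Definition frank U (f : T -> seq (U * bool)) := logn 2 #|homs f 2|.

Lemma card_homs U (f : T -> seq (U * bool)) n : #|homs f n| = n`! ^ frank f.
Proof.
have [I [v vP]] := nielsen_schreier f.
by rewrite (card_homs_basis _ vP) /frank (card_homs_basis _ vP) (pfactorK _ (isT : prime 2`!)).
Qed.

Lemma frank_max U (f : T -> seq (U * bool)) : frank f <= #|T|.
Proof.
rewrite -(@leq_exp2l 2) //; have := card_homs f 2; rewrite -[2`!]/2 => <-.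
by apply: leq_trans (max_card _) _; rewrite card_ffun card_Sn.
Qed.

Lemma sub_homs U U' (f : T -> seq (U * bool)) (g : T -> seq (U' * bool)) n :
  (forall w, fker f w -> fker g w) -> homs g n \subset homs f n.
Proof. by move=> fg; apply/subsetP => s /homsP sP; apply/homsP => w /fg/sP. Qed.

Lemma frank_mono U U' (f : T -> seq (U * bool)) (g : T -> seq (U' * bool)) :
  (forall w, fker f w -> fker g w) -> frank g <= frank f.
Proof.
move=> fg; rewrite -(@leq_exp2l 2) // -[2]/(2`!) -!card_homs.
exact/subset_leq_card/sub_homs.
Qed.

(** If [f] did not kill [w], some homomorphism from its image to S_n would not either. Equal ranks
    turn the inclusion of [homs g n] in [homs f n] into an equality, so this homomorphism factors
    through the image of [g], where [w] is trivial. *)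
Lemma fker_eq_rank U U' (f : T -> seq (U * bool)) (g : T -> seq (U' * bool)) w :
  (forall w, fker f w -> fker g w) -> frank f = frank g -> fker g w -> fker f w.
Proof.
move=> fg rfg gw; apply: contrapT => /residually_finite [n [s]].
rewrite fev_fsub; set t := [ffun x => fev s (f x)] : {ffun T -> 'S_n}.
rewrite -(@eq_fev _ _ t); last by move=> x; rewrite ffunE.
suff /homsP/(_ _ gw) -> : t \in homs g n by rewrite eqxx.
have /eqP -> : homs g n == homs f n.
  by rewrite eqEcard sub_homs //= !card_homs rfg.
apply/homsP => u fu; rewrite (eq_fev (ffunE _)) -fev_fsub.
exact: (@fev_feq _ _ _ _ [::]).
Qed.

(** Shrinking kernels have growing ranks, bounded by the size of [T]; from an index of maximal rank
    on, the kernels agree. *)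
Lemma fker_descending U (f : nat -> T -> seq (U * bool)) :
  (forall k w, fker (f k.+1) w -> fker (f k) w) ->
  exists k, forall w, (forall l, fker (f l) w) <-> fker (f k) w.
Proof.
move=> fS; have fD k l w : fker (f (l + k)) w -> fker (f k) w.
  by elim: l => // l IH; rewrite addSn => /fS.
pose P r := `[< exists k, frank (f k) = r >].
have exP : exists r, P r by exists (frank (f 0)); apply/asboolP; exists 0.
have Pmax r : P r -> r <= #|T| by move=> /asboolP[k <-]; apply: frank_max.
case: (ex_maxnP exP Pmax) => r /asboolP[k kr] rP; exists k => w; split=> // fw l.
have [lk|/ltnW kl] := leqP l k; first by apply: (@fD l (k - l)); rewrite subnK.
apply: fker_eq_rank fw; first by move=> u; rewrite -(subnK kl); apply: fD.
apply/eqP; rewrite eqn_leq kr rP /= -?kr; last by apply/asboolP; exists l.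
by apply: frank_mono => u; rewrite -(subnK kl); apply: fD.
Qed.

(** Growing kernels have decreasing ranks; from an index of minimal rank on, the kernels agree. *)
Lemma fker_ascending U (f : nat -> T -> seq (U * bool)) :
  (forall k w, fker (f k) w -> fker (f k.+1) w) ->
  exists k, forall w, (exists l, fker (f l) w) <-> fker (f k) w.
Proof.
move=> fS; have fD k l w : fker (f k) w -> fker (f (l + k)) w.
  by elim: l => // l IH /IH; rewrite addSn => /fS.
pose P r := `[< exists k, frank (f k) = r >].
have exP : exists r, P r by exists (frank (f 0)); apply/asboolP; exists 0.
case: (ex_minnP exP) => r /asboolP[k kr] rP; exists k => w; split; last by exists k.
case=> l fw; have [lk|/ltnW kl] := leqP l k.
  by rewrite -(subnK lk); apply: fD.
apply: fker_eq_rank fw; first by move=> u; rewrite -(subnK kl); apply: fD.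
apply/eqP; rewrite eqn_leq kr rP /= -?kr; last by apply/asboolP; exists l.
by apply: frank_mono => u; rewrite -(subnK kl); apply: fD.
Qed.

(** For each [m] the intersection over [k] is a single kernel; these kernels grow with [m], so their
    union is again one of them. *)
Lemma fker_double_limit U (f : nat -> nat -> T -> seq (U * bool)) :
  (forall m k w, fker (f m k.+1) w -> fker (f m k) w) ->
  (forall m k w, fker (f m k) w -> fker (f m.+1 k) w) ->
  exists g : T -> seq (U * bool),
    forall w, (exists m, forall k, fker (f m k) w) <-> fker g w.
Proof.
move=> fk fm; have [l lP] := choice (fun m => fker_descending (fk m)).
have [m w|m mP] := @fker_ascending _ (fun m => f m (l m)).
  by move=> /lP fw; apply/lP => k; apply: fm.
exists (f m (l m)) => w; rewrite -mP.
by split=> -[m' fw]; exists m'; apply/lP.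
Qed.

End Rank.

(** * Finite projections of infinite words *)

(** Identifies the free product of copies of Z with the free group on [nat], to which free reduction
    applies. *)
Definition zexp (a : nat * Z) : seq (nat * bool) :=
  nseq (Z.abs_nat a.2) (a.1, (0 <=? a.2)%coqZ).
Definition expand (l : seq (nat * Z)) := flatten (map zexp l).

Lemma expand_cat l l' : expand (l ++ l') = expand l ++ expand l'.
Proof. by rewrite /expand map_cat flatten_cat. Qed.

Lemma zexp_nat n k : zexp (n, Z.of_nat k) = nseq k (n, true).
Proof. by rewrite /zexp /= Zabs2Nat.id (_ : (0 <=? _)%coqZ = true) //; lia. Qed.

Lemma zexp_oppnat n k : zexp (n, (- Z.of_nat k)%coqZ) = nseq k (n, false).
Proof.
case: k => // k; set z := (- Z.of_nat k.+1)%coqZ.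
rewrite -[LHS]/(nseq (Z.abs_nat z) (n, (0 <=? z)%coqZ)).
have -> : Z.abs_nat z = k.+1 by lia.
by have -> : (0 <=? z)%coqZ = false by lia.
Qed.

Lemma Z_nat_ind (P : Z -> Prop) :
  (forall k, P (Z.of_nat k)) -> (forall k, P (- Z.of_nat k)%coqZ) -> forall z, P z.
Proof.
move=> Pp Pn z; have [z0|z0] : (0 <= z \/ z <= 0)%coqZ by lia.
  by rewrite -(Z2Nat.id z z0).
by rewrite (_ : z = - Z.of_nat (Z.to_nat (- z)))%coqZ //; lia.
Qed.

Lemma zexp_opp a : zexp (a.1, (- a.2)%coqZ) = finv (zexp a).
Proof.
have H k x b : finv (nseq k (x, b)) = nseq k (x, ~~ b) :> seq (nat * bool).
  by rewrite /finv map_nseq rev_nseq.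
case: a => n; elim/Z_nat_ind => k /=.
  by rewrite zexp_nat zexp_oppnat H.
by rewrite Z.opp_involutive zexp_nat zexp_oppnat H.
Qed.

Lemma zexp_succ n z : zexp (n, (1 + z)%coqZ) ≈ (n, true) :: zexp (n, z).
Proof.
elim/Z_nat_ind: z => k.
  have -> : (1 + Z.of_nat k = Z.of_nat k.+1)%coqZ by lia.
  by rewrite !zexp_nat.
case: k => [|k] //.
have -> : (1 + - Z.of_nat k.+1 = - Z.of_nat k)%coqZ by lia.
by rewrite !zexp_oppnat; symmetry; apply: (feq_cancel2 (n, true)).
Qed.

Lemma zexp_pred n z : zexp (n, (-1 + z)%coqZ) ≈ (n, false) :: zexp (n, z).
Proof.
have -> : zexp (n, z) = zexp (n, (1 + (-1 + z))%coqZ) by do 2 f_equal; lia.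
by rewrite zexp_succ; symmetry; apply: (feq_cancel2 (n, false)).
Qed.

Lemma zexp_add n z z' : zexp (n, (z + z')%coqZ) ≈ zexp (n, z) ++ zexp (n, z').
Proof.
elim/Z_nat_ind: z => k; elim: k => [|k IH] //.
  have -> : (Z.of_nat k.+1 + z' = 1 + (Z.of_nat k + z'))%coqZ by lia.
  by rewrite zexp_succ IH !zexp_nat.
have -> : (- Z.of_nat k.+1 + z' = -1 + (- Z.of_nat k + z'))%coqZ by lia.
by rewrite zexp_pred IH !zexp_oppnat.
Qed.

Lemma expand_push a r : expand (push a r) ≈ zexp a ++ expand r.
Proof.
case: r => [|[n z] r] //=; case: Nat.eqb_spec => // an.
rewrite /expand /= -/(expand r) catA (_ : zexp a ++ zexp (n, z) ≈ zexp (n, a.2 + z)%coqZ).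
  by case: Z.eqb_spec => [->|] //=.
by rewrite zexp_add -an; case: (a).
Qed.

Lemma expand_reduce l : expand (reduce l) ≈ expand l.
Proof.
elim: l => // a l IH; rewrite -[reduce _]/(push a (reduce l)) expand_push.
exact: feq_cat.
Qed.

(** * Normal forms in the free product compared with free reduction *)

Definition nzletters (l : seq (nat * Z)) : Prop := forall a, In a l -> a.2 <> 0%coqZ.

Fixpoint alternating (l : seq (nat * Z)) : Prop :=
  if l is a :: l' then
    [/\ a.2 <> 0%coqZ, (if l' is b :: _ then a.1 <> b.1 else True) & alternating l']
  else True.

(** Accepting the trivial letter makes each copy of Z act on normal forms; see [push0_add]. *)
Definition push0 (a : nat * Z) r := if Z.eqb a.2 0 then r else push a r.

Lemma alternating_push0 a r : alternating r -> alternating (push0 a r).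
Proof.
rewrite /push0; case: Z.eqb_spec => // a0.
case: r => [|[n z] r] //= [z0 nr ar]; case: Nat.eqb_spec => //= an.
by case: Z.eqb_spec.
Qed.

Lemma push0_add n z z' r : alternating r ->
  push0 (n, z) (push0 (n, z') r) = push0 (n, (z + z')%coqZ) r.
Proof.
rewrite /push0 /=; case: (Z.eqb_spec z' 0) => [->|z0'].
  by rewrite Z.add_0_r.
case: (Z.eqb_spec z 0) => [->|z0 ar].
  by rewrite Z.add_0_l; case: Z.eqb_spec.
case: r ar => [|[n' y] r] /=.
  by move=> _; rewrite Nat.eqb_refl; case: Z.eqb_spec.
move=> [y0 nr ar]; case: (Nat.eqb_spec n n') => [nn|nn] /=; last first.
  rewrite Nat.eqb_refl; case: (Z.eqb_spec (z + z') 0) => //.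
have pr : forall x, x <> 0%coqZ -> push (n, x) r = (n, x) :: r.
  move=> x _; case: r nr {ar} => //= -[m v] r /= nm.
  by case: Nat.eqb_spec => //; congruence.
subst n'; case: (Z.eqb_spec (z' + y) 0) => [e|e]; last first.
  rewrite /= Nat.eqb_refl.
  case: (Z.eqb_spec (z + z') 0) => [f|f].
    rewrite (_ : z + (z' + y) = y)%coqZ; last by lia.
    by case: Z.eqb_spec.
  by rewrite Z.add_assoc.
rewrite pr //; case: (Z.eqb_spec (z + z') 0) => [f|f].
  by rewrite (_ : z = y) //; lia.
case: Z.eqb_spec => [|_]; first by lia.
by do 2 f_equal; lia.
Qed.

(** Since the action is additive, a letter [(n, z)] may be pushed as |z| letters of exponent 1 or
    -1. *)
Lemma reduce_expand l : nzletters l ->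
  reduce l = foldr (fun a => push0 (a.1, if a.2 then 1%coqZ else (-1)%coqZ)) [::] (expand l).
Proof.
set g := fun a => _.
have gP a r : alternating r -> alternating (g a r) by apply: alternating_push0.
have fP u r : alternating r -> alternating (foldr g r u).
  by move=> ar; elim: u => //= a u; apply: gP.
have g_zexp n z r : alternating r -> foldr g r (zexp (n, z)) = push0 (n, z) r.
  move=> ar; elim/Z_nat_ind: z => k; rewrite ?zexp_nat ?zexp_oppnat;
    elim: k => //= k ->; rewrite /g /= push0_add //; do 2 f_equal; lia.
elim: l => //= -[n z] l IH nz; rewrite IH; last by move=> a al; apply: nz; right.
rewrite /expand /= foldr_cat g_zexp; last exact: fP.
by rewrite /push0; case: Z.eqb_spec (nz (n, z) (or_introl erefl)).
Qed.

(** Reduction preserves the expanded word up to free equality. Conversely, [reduce] is an action of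
    the expanded letters, so it factors through [fred]. *)
Lemma reduce_eqP l l' : nzletters l -> nzletters l' ->
  reduce l = reduce l' <-> expand l ≈ expand l'.
Proof.
move=> nl nl'; split=> [E|E].
  by rewrite -(expand_reduce l) E expand_reduce.
rewrite !reduce_expand //; set g := fun a => _.
suff H u : foldr g [::] u = foldr g [::] (fred u) by rewrite H E -H.
rewrite (@foldr_fred _ _ g alternating) //.
  by move=> a s; apply: alternating_push0.
move=> [n b] s ar; rewrite /g /= push0_add //.
by case: b.
Qed.

(** * Lists and strongly sorted sequences *)

Lemma In_map (A B : Type) (f : A -> B) s y :
  In y (map f s) <-> exists x, f x = y /\ In x s.
Proof. exact: in_map_iff. Qed.

Lemma In_filter (A : Type) (p : pred A) s x : In x (filter p s) <-> In x s /\ p x.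
Proof. exact: filter_In. Qed.

Lemma In_cat (A : Type) (s t : seq A) x : In x (s ++ t) <-> In x s \/ In x t.
Proof. exact: in_app_iff. Qed.

Lemma In_rev (A : Type) (s : seq A) x : In x (rev s) <-> In x s.
Proof.
by elim: s => // y s IH; rewrite rev_cons -cats1 In_cat IH /=; tauto.
Qed.

Lemma In_mem (T : eqType) (s : seq T) y : reflect (In y s) (y \in s).
Proof.
elim: s => [|x s IH]; first by constructor.
rewrite inE eq_sym; apply: (iffP orP) => /= -[E|/IH]; [|by right| |by right].
  by left; apply/eqP.
by left; apply/eqP.
Qed.

Lemma ssorted_cons (A : Type) (R : A -> A -> Prop) a s :
  StronglySorted R (a :: s) <-> StronglySorted R s /\ forall b, In b s -> R a b.
Proof.
split=> [H|[H1 H2]]; first by inversion H; subst; split=> //; apply/Forall_forall.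
by constructor => //; apply/Forall_forall.
Qed.

Lemma ssorted_cat (A : Type) (R : A -> A -> Prop) s t :
  StronglySorted R (s ++ t) <->
  [/\ StronglySorted R s, StronglySorted R t & forall a b, In a s -> In b t -> R a b].
Proof.
elim: s => [|a s IH] /=; first by split=> [|[]] //; split=> //; constructor.
split.
  move=> /ssorted_cons[/IH[ss st R1] R2]; split=> //.
    by apply/ssorted_cons; split=> // b bs; apply: R2; apply/In_cat; left.
  by move=> c b [<- bt|cs bt]; [apply: R2; apply/In_cat; right|apply: R1].
move=> [/ssorted_cons[ss R1] st R2]; apply/ssorted_cons; split.
  by apply/IH; split=> // c b cs bt; apply: R2 => //; right.
by move=> b /In_cat[bs|bt]; [apply: R1|apply: R2 => //; left].
Qed.

Lemma ssorted_map (A B : Type) (R : B -> B -> Prop) (f : A -> B) s :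
  StronglySorted R (map f s) <-> StronglySorted (fun x y => R (f x) (f y)) s.
Proof.
elim: s => [|a s IH] /=; first by split; constructor.
rewrite !ssorted_cons IH; split=> -[? H]; split=> // b.
  by move=> bs; apply/H/In_map; exists b.
by move=> /In_map[x [<- xs]]; apply: H.
Qed.

Lemma ssorted_filter (A : Type) (R : A -> A -> Prop) (p : pred A) s :
  StronglySorted R s -> StronglySorted R (filter p s).
Proof.
elim: s => //= a s IH /ssorted_cons[ss sR]; case: ifP => _; last exact: IH.
by apply/ssorted_cons; split; [apply: IH|move=> b /In_filter[bs _]; apply: sR].
Qed.

Lemma ssorted_rev (A : Type) (R : A -> A -> Prop) s :
  StronglySorted R s -> StronglySorted (fun x y => R y x) (rev s).
Proof.
elim: s => [|a s IH]; first by constructor.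
move=> /ssorted_cons[ss sR]; rewrite rev_cons -cats1; apply/ssorted_cat; split.
- exact: IH.
- by apply/ssorted_cons; split=> //; constructor.
- by move=> b c /In_rev bs /= [<-|[]]; apply: sR.
Qed.

Lemma ssorted_impl (A : Type) (R R' : A -> A -> Prop) s :
  (forall x y, R x y -> R' x y) -> StronglySorted R s -> StronglySorted R' s.
Proof.
move=> RR; elim: s => [|a s IH]; first by constructor.
by move=> /ssorted_cons[ss sR]; apply/ssorted_cons; split; [apply: IH|move=> b /sR/RR].
Qed.

Lemma ssorted_uniq (A : Type) (R : A -> A -> Prop) s t :
  (forall x, ~ R x x) -> (forall x y, R x y -> ~ R y x) ->
  StronglySorted R s -> StronglySorted R t -> (forall x, In x s <-> In x t) -> s = t.
Proof.
move=> irr asym; elim: s t => [|a s IH] [|b t] //.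
- by move=> _ _ /(_ b) [_ /(_ (or_introl erefl))].
- by move=> _ _ /(_ a) [/(_ (or_introl erefl))].
move=> /ssorted_cons[ss sR] /ssorted_cons[st tR] st_eq.
have ab : a = b.
  have [[->//|at_] _] : (b = a \/ In a t) /\ True.
    by split=> //; apply/(st_eq a); left.
  have [//|bs] : a = b \/ In b s by apply/(st_eq b); left.
  by case: (asym _ _ (tR _ at_)); apply: sR.
subst b; congr (_ :: _); apply: IH => // x; split=> xs.
  by have [ax|//] := (st_eq x).1 (or_intror xs); case: (irr x); rewrite -{1}ax; apply: sR.
by have [ax|//] := (st_eq x).2 (or_intror xs); case: (irr x); rewrite -{1}ax; apply: tR.
Qed.

(** * Enumerations of the letters of bounded index *)

Section Enumeration.
Variables (w : rawword) (ww : IsWord w).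

Let irr i : ~ wlt w i i. Proof. by case: ww. Qed.
Let trans i j k : wlt w i j -> wlt w j k -> wlt w i k.
Proof. by case: ww => _ [+ _]; apply. Qed.
Let total i j : wlt w i j \/ i = j \/ wlt w j i.
Proof. by case: ww => _ [_ [+ _]]; apply. Qed.

Lemma Enum_ssorted m s :
  Enum w m s <-> StronglySorted (wlt w) s /\
                 forall i, In i s <-> (fst (letter w i) < m)%nat.
Proof.
split=> -[ss sP]; split.
- by apply: Sorted_StronglySorted => // i j k; apply: trans.
- by move=> i; rewrite sP; lia.
- exact: StronglySorted_Sorted.
- by move=> i; rewrite sP; lia.
Qed.

Let insert i s : StronglySorted (wlt w) s ->
  exists s', StronglySorted (wlt w) s' /\ forall j, In j s' <-> i = j \/ In j s.
Proof.
elim: s => [_|a s IH /ssorted_cons[ss sR]].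
  by exists [:: i]; split=> //; apply/ssorted_cons; split=> //; constructor.
have [ia|[ia|ai]] := total i a.
- exists [:: i, a & s]; split=> //; apply/ssorted_cons; split.
    exact/ssorted_cons.
  by move=> b /= [<-//|/sR]; apply: trans.
- subst a; exists (i :: s); split=> [|j]; first exact/ssorted_cons.
  by split=> [|[<-|]] //; [right|left].
- have [s' [ss' s'P]] := IH ss; exists (a :: s'); split=> [|j].
    by apply/ssorted_cons; split=> // b /s'P[<-//|]; apply: sR.
  by rewrite [In j (a :: s')]/= [In j (a :: s)]/= s'P; tauto.
Qed.

(** Each factor below [m] contributes finitely many letters; a list containing all of them is sorted
    by insertion and then filtered. *)
Lemma Enum_ex m : exists s, Enum w m s.
Proof.
have [l lP] : exists l, forall i, (fst (letter w i) < m)%nat -> In i l.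
  elim: m => [|m [l lP]]; first by exists [::].
  have [_ [_ [_ [_ [_ /(_ m)[l' l'P]]]]]] := ww.
  exists (l ++ l') => i; rewrite ltnS leq_eqVlt => /orP[/eqP/l'P|/lP] il.
    by apply/In_cat; right.
  by apply/In_cat; left.
have [s [ss sl]] : exists s, StronglySorted (wlt w) s /\ forall i, In i s <-> In i l.
  elim: l {lP} => [|i l [s [ss sl]]]; first by exists [::]; split=> //; constructor.
  have [s' [ss' s'P]] := insert i ss; exists s'; split=> // j.
  by rewrite s'P sl.
exists (filter (fun i => fst (letter w i) < m)%nat s); apply/Enum_ssorted; split.
  exact: ssorted_filter.
by move=> i; rewrite In_filter sl; split=> [[]|im] //; split=> //; apply: lP.
Qed.

Lemma ssorted_wlt_uniq s t : StronglySorted (wlt w) s -> StronglySorted (wlt w) t ->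
  (forall i, In i s <-> In i t) -> s = t.
Proof.
apply: ssorted_uniq => // i j ij ji; apply: (@irr i); exact: trans ji.
Qed.

Lemma Enum_uniq m s t : Enum w m s -> Enum w m t -> s = t.
Proof.
move=> /Enum_ssorted[ss sP] /Enum_ssorted[st tP].
by apply: ssorted_wlt_uniq => // i; rewrite sP tP.
Qed.

End Enumeration.

(* The finite word [p_m w] before reduction, and its expansion into letters
   [(n, true)], [(n, false)] for the generator of the n-th factor and its inverse. *)
Definition proj_word (w : rawword) (m : nat) : seq (nat * Z) :=
  if pselect (exists s, Enum w m s) is left h then map (letter w) (projT1 (cid h))
  else [::].
Definition proj (w : rawword) m : seq (nat * bool) := expand (proj_word w m).

Lemma proj_wordE w m s : IsWord w -> Enum w m s -> proj_word w m = map (letter w) s.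
Proof.
move=> ww ws; rewrite /proj_word; case: pselect => [h|[]]; last by exists s.
by case: cid => t wt /=; rewrite (Enum_uniq ww ws wt).
Qed.

Lemma projE w m s : IsWord w -> Enum w m s -> proj w m = expand (map (letter w) s).
Proof. by move=> ww ws; rewrite /proj (proj_wordE ww ws). Qed.

Lemma nz_proj w m : IsWord w -> nzletters (proj_word w m).
Proof.
move=> ww; have [s ws] := Enum_ex ww m; rewrite (proj_wordE ww ws) => a.
by move=> /In_map[i [<- _]]; case: ww => _ [_ [_ [_ []]]].
Qed.

Lemma wequivP x y : IsWord x -> IsWord y ->
  wequiv x y <-> forall m, proj x m ≈ proj y m.
Proof.
move=> wx wy; split=> [E m|E m s t xs yt].
  apply/reduce_eqP; [exact: nz_proj..|].
  have [s xs] := Enum_ex wx m; have [t yt] := Enum_ex wy m.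
  by rewrite (proj_wordE wx xs) (proj_wordE wy yt); apply: E xs yt.
move/reduce_eqP: (E m) => /(_ (nz_proj wx) (nz_proj wy)).
by rewrite (proj_wordE wx xs) (proj_wordE wy yt).
Qed.

(** * Projections of concatenations, inverses and subwords *)

Lemma IsWord_empty : IsWord wempty.
Proof.
do 3 (split; first by case).
split; first by exists (fun=> 0) => -[].
by split=> [[]|n]; exists [::] => -[].
Qed.

Lemma proj_empty m : proj wempty m = [::].
Proof.
have E : Enum wempty m [::] by split; [constructor|case].
by rewrite (projE IsWord_empty E).
Qed.

Lemma IsWord_concat x y : IsWord x -> IsWord y -> IsWord (wconcat x y).
Proof.
move=> [ix [tx [cx [[f fx] [nx lx]]]]] [iy [ty [cy [[g gy] [ny ly]]]]].
split; first by case=> i /=.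
split; first by case=> i [] j [] k //=; eauto.
split.
  case=> i [] j //=; [|by left|by right; right|].
    by have [?|[->|?]] := cx i j; [left|right; left|right; right].
  by have [?|[->|?]] := cy i j; [left|right; left|right; right].
split.
  exists (fun z => match z with inl i => (f i).*2 | inr j => (g j).*2.+1 end).
  by case=> i [] j => E; try lia; congr (_ _); [apply: fx|apply: gy]; lia.
split; first by case.
move=> n; have [l lP] := lx n; have [l' lP'] := ly n.
exists (map inl l ++ map inr l') => -[] i /= E; apply/In_cat; [left|right];
  apply/In_map; exists i; auto.
Qed.

Lemma Enum_concat x y m s t : IsWord x -> IsWord y -> Enum x m s -> Enum y m t ->
  Enum (wconcat x y) m (map inl s ++ map inr t).
Proof.
move=> wx wy /(Enum_ssorted wx)[ss sP] /(Enum_ssorted wy)[st tP].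
apply/(Enum_ssorted (IsWord_concat wx wy)); split.
  apply/ssorted_cat; split; [exact/ssorted_map|exact/ssorted_map|].
  by move=> a b /In_map[i [<- _]] /In_map[j [<- _]].
move=> [] i /=; rewrite In_cat !In_map -?sP -?tP; split.
- by case=> -[j [// [<-]]].
- by move=> ii; left; exists i.
- by case=> -[j [// [<-]]].
- by move=> ii; right; exists i.
Qed.

Lemma proj_concat x y m : IsWord x -> IsWord y ->
  proj (wconcat x y) m = proj x m ++ proj y m.
Proof.
move=> wx wy; have [s xs] := Enum_ex wx m; have [t yt] := Enum_ex wy m.
rewrite (projE (IsWord_concat wx wy) (Enum_concat wx wy xs yt)).
by rewrite (projE wx xs) (projE wy yt) map_cat expand_cat -!map_comp.
Qed.

Lemma IsWord_inv x : IsWord x -> IsWord (winv x).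
Proof.
move=> [ix [tx [cx [fx [nx lx]]]]]; split; first exact: ix.
split; first by move=> i j k /= ij jk; apply: tx jk ij.
split; first by move=> i j /=; have [?|[?|?]] := cx i j; auto.
do 2 (split; first by [|move=> i /=; move: (nx i); lia]).
exact: lx.
Qed.

Lemma proj_inv x m : IsWord x -> proj (winv x) m = finv (proj x m).
Proof.
move=> wx; have [s xs] := Enum_ex wx m; rewrite (projE wx xs).
have xs' : Enum (winv x) m (rev s).
  move: xs => /(Enum_ssorted wx)[ss sP].
  apply/(Enum_ssorted (IsWord_inv wx)); split; first exact: ssorted_rev.
  by move=> i; rewrite In_rev sP.
rewrite (projE (IsWord_inv wx) xs'); elim: s {xs xs'} => // i s IH.
rewrite rev_cons -cats1 map_cat expand_cat IH /= -cat1s expand_cat finv_cat.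
by rewrite /expand /= !cats0 zexp_opp.
Qed.

Definition subword (w : rawword) (p : pred (carrier w)) : rawword :=
  RawWord {i | p i} (fun i j => wlt w (sval i) (sval j)) (fun i => letter w (sval i)).

Lemma sval_bool_inj (A : Type) (p : pred A) (x y : {a | p a}) : sval x = sval y -> x = y.
Proof.
by case: x y => [x px] [y py] /= e; subst y; rewrite (bool_irrelevance px py).
Qed.

Lemma sval_lift (A : Type) (p : pred A) (s : seq A) :
  exists t : seq {a | p a}, map sval t = filter p s.
Proof.
elim: s => [|a s [t tE]] /=; first by exists [::].
case: (boolP (p a)) => pa; last by exists t.
by exists (exist _ a pa :: t); rewrite /= tE.
Qed.

Lemma IsWord_sub w p : IsWord w -> IsWord (@subword w p).
Proof.
move=> [ix [tx [cx [[f fx] [nx lx]]]]]; split; first by move=> i; apply: ix.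
split; first by move=> i j k; apply: tx.
split.
  move=> i j; have [?|[?|?]] := cx (sval i) (sval j); auto.
  by right; left; apply: sval_bool_inj.
split; first by exists (f \o sval) => i j /fx/sval_bool_inj.
split; first by move=> i; apply: nx.
move=> n; have [l lP] := lx n; have [t tE] := sval_lift p l.
exists t => -[i pi] /lP /= il.
have /In_map[j [ji jt]] : In i (map sval t) by rewrite tE; apply/In_filter.
by rewrite (_ : exist _ i pi = j) //; apply: sval_bool_inj.
Qed.

Lemma proj_sub w p m s : IsWord w -> Enum w m s ->
  proj (@subword w p) m = expand (map (letter w) (filter p s)).
Proof.
move=> ww /(Enum_ssorted ww)[ss sP]; have [t tE] := sval_lift p s.
rewrite (@projE (subword p) m t); [|exact: IsWord_sub|].
  by rewrite -tE -map_comp.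
apply/(Enum_ssorted (IsWord_sub p ww)); split.
  by apply/(ssorted_map (wlt w)); rewrite tE; apply: ssorted_filter.
move=> i; rewrite -[letter _ _]/(letter w (sval i)) -sP; split=> [it|ii].
  have : In (sval i) (map sval t) by apply/In_map; exists i.
  by rewrite tE => /In_filter[].
have /In_map[j [ji jt]] : In (sval i) (map sval t).
  by rewrite tE; apply/In_filter; split=> //; case: (i).
by rewrite -(sval_bool_inj ji).
Qed.

Lemma filter_expand (q : pred nat) l :
  [seq a <- expand l | q a.1] = expand [seq b <- l | q b.1].
Proof.
elim: l => // -[n z] l IH; rewrite /= /expand /= -/(expand _) filter_cat IH filter_nseq /=.
by case: (q n); rewrite ?mul1n ?mul0n.
Qed.

Lemma proj_widen w m k : IsWord w -> m <= k ->
  proj w m = [seq a <- proj w k | a.1 < m].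
Proof.
move=> ww mk; have [s ws] := Enum_ex ww k; rewrite (projE ww ws).
rewrite (@projE _ m (filter (fun i => fst (letter w i) < m) s)) //.
  by rewrite (filter_expand (fun n => n < m)) filter_map.
move: ws => /(Enum_ssorted ww)[ss sP]; apply/(Enum_ssorted ww); split.
  exact: ssorted_filter.
by move=> i; rewrite In_filter sP; split=> [[]//|im]; split=> //; apply: leq_trans mk.
Qed.

(** * Tails and the kernel of the projection onto A(Z) *)

Definition tail m (u : seq (nat * bool)) := [seq a <- u | m <= a.1].

Lemma tail_feq m u v : u ≈ v -> tail m u ≈ tail m v.
Proof. exact: (feq_filter (fun n => m <= n)). Qed.

Lemma tail_cat m u v : tail m (u ++ v) = tail m u ++ tail m v.
Proof. exact: filter_cat. Qed.

Lemma tail_finv m u : tail m (finv u) = finv (tail m u).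
Proof. by rewrite /tail /finv filter_rev filter_map. Qed.

Lemma tail_widen m n u : m <= n -> tail n (tail m u) = tail n u.
Proof.
move=> mn; rewrite /tail -filter_predI; apply: eq_filter => a /=.
by apply: andb_idr; apply: leq_trans.
Qed.

Definition atriv x := exists m, forall k, tail m (proj x k) ≈ [::].

Lemma atriv_mul x y : IsWord x -> IsWord y -> atriv x -> atriv y -> atriv (wconcat x y).
Proof.
move=> wx wy [m xm] [n yn]; exists (maxn m n) => k.
rewrite proj_concat // tail_cat -(tail_widen _ (leq_maxl m n)).
rewrite -[X in _ ++ X](tail_widen _ (leq_maxr m n)).
have E l u : u ≈ [::] -> tail l u ≈ [::] by move/(tail_feq l).
by rewrite (E _ _ (xm k)) (E _ _ (yn k)).
Qed.

(** Triviality of a tail passes through each rule of [InN]; for a finite word, [m] is taken beyond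
    all its indices. *)
Lemma InN_atriv x : InN x -> IsWord x /\ atriv x.
Proof.
elim=> {x} [x wx [l lP]|x y _ [wx [m xm]] wy /(wequivP wx wy) xy
           |x y _ [wx xm] _ [wy yn]|x _ [wx [m xm]]|u x wu _ [wx [m xm]]].
- split=> //; exists (foldr (fun i n => maxn n (fst (letter x i)).+1) 0 l) => k.
  set m := foldr _ _ _; have mP i : fst (letter x i) < m.
    have := lP i; rewrite {}/m; elim: l {lP} => //= j l IH [->|/IH]; lia.
  have [s xs] := Enum_ex wx k.
  rewrite (projE wx xs) /tail (filter_expand (fun n => m <= n)).
  suff -> : [seq b <- map (letter x) s | m <= b.1] = [::] by [].
  by elim: s {xs} => //= i s ->; rewrite leqNgt mP.
- split=> //; exists m => k; rewrite -(xm k); apply: tail_feq; symmetry; exact: xy.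
- by split; [apply: IsWord_concat|apply: atriv_mul].
- split; first exact: IsWord_inv.
  by exists m => k; rewrite proj_inv // tail_finv xm.
- have wux := IsWord_concat wu wx; have wui := IsWord_inv wu.
  split; first exact: IsWord_concat.
  exists m => k; rewrite !proj_concat // proj_inv // !tail_cat xm cats0 tail_finv.
  exact: feq_catV.
Qed.

(* Letters of index [< m] are removed one at a time: if [x = A i B] then
   [x = (A i A^-1) (A B)], where the letter [i] is a finite word. *)
Lemma atriv_InN x : IsWord x -> atriv x -> InN x.
Proof.
move=> wx [m xm]; have [s xs] := Enum_ex wx m.
(* Induction on the number of letters of index below [m]. *)
have [n] := ubnP (size s); elim: n x wx s xm xs => // n IH x wx s xm xs sn.
case: s xs sn => [|i s] xs sn.
  apply: (@InN_equiv wempty) => //.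
    by apply: InN_fin; [exact: IsWord_empty|exists [::]; case].
  apply/(wequivP IsWord_empty wx) => k; rewrite proj_empty -(xm k) /tail.
  rewrite (_ : [seq a <- _ | _] = proj x k) //; apply/all_filterP/allP => a ak.
  rewrite leqNgt; apply/negP => am; have := projE wx xs; rewrite -[RHS]/[::].
  have [mk|km] := leqP m k.
    rewrite (proj_widen wx mk) => E.
    have : a \in [seq a <- proj x k | a.1 < m] by rewrite mem_filter am.
    by rewrite E.
  move=> E; move: ak; rewrite (proj_widen wx (ltnW km)) E.
  by [].
pose A := subword (fun j => `[< wlt x j i >]).
pose I := subword (fun j => `[< j = i >]).
pose B := subword (fun j => `[< wlt x i j >]).
have wA : IsWord A by apply: IsWord_sub.
have wI : IsWord I by apply: IsWord_sub.
have wB : IsWord B by apply: IsWord_sub.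
have split3 t : StronglySorted (wlt x) t -> t = [seq j <- t | `[< wlt x j i >]] ++
    [seq j <- t | `[< j = i >]] ++ [seq j <- t | `[< wlt x i j >]].
  move=> st; have [ix [tx [cx _]]] := wx.
  apply: (ssorted_wlt_uniq wx) => //.
    apply/ssorted_cat; split; [exact: ssorted_filter| |].
      apply/ssorted_cat; split; [exact: ssorted_filter..|].
      by move=> a b /In_filter[_ /asboolP ->] /In_filter[_ /asboolP].
    move=> a b /In_filter[_ /asboolP ai] /In_cat[] /In_filter[_ /asboolP]; first by move=> ->.
    exact: tx.
  move=> j; rewrite !In_cat !In_filter !asboolE; have := cx j i; tauto.
have projABI k : proj x k = proj A k ++ proj I k ++ proj B k.
  have [t xt] := Enum_ex wx k; rewrite !(proj_sub _ wx xt) (projE wx xt).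
  rewrite -!expand_cat -!map_cat -split3 //.
  by move: xt => /(Enum_ssorted wx)[].
have im : fst (letter x i) < m.
  by move: xs => /(Enum_ssorted wx)[_ sP]; apply/sP; left.
have Im k : tail m (proj I k) = [::].
  have [t xt] := Enum_ex wx k; rewrite (proj_sub _ wx xt) /tail.
  rewrite (filter_expand (fun n => m <= n)).
  elim: t {xt} => //= j t; case: asboolP => //= -> E.
  by rewrite leqNgt im.
have wAB := IsWord_concat wA wB; have wAI := IsWord_concat wA wI.
have wiA := IsWord_inv wA.
have NAB : InN (wconcat A B).
  have [t tE] := Enum_ex wAB m; apply: (IH _ wAB t) => // [k|].
    by rewrite proj_concat // tail_cat -(xm k) projABI !tail_cat Im.
  have [a Aa] := Enum_ex wA m; have [b Bb] := Enum_ex wB m.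
  have [c Ic] := Enum_ex wI m.
  rewrite (Enum_uniq wAB tE (Enum_concat wA wB Aa Bb)) size_cat !size_map.
  have size_sub p d : Enum (@subword x p) m d -> size d = size (filter p (i :: s)).
    move=> pd; have [d' d'E] := sval_lift p (i :: s).
    have wp : IsWord (subword p) by apply: IsWord_sub.
    rewrite -d'E size_map; congr size; apply: (Enum_uniq wp pd).
    move: xs => /(Enum_ssorted wx)[ss sP]; apply/(Enum_ssorted wp); split.
      by apply/(ssorted_map (wlt x)); rewrite d'E; apply: ssorted_filter.
    move=> j; rewrite -[letter _ _]/(letter x (sval j)) -sP; split=> jd.
      have : In (sval j) (map sval d') by apply/In_map; exists j.
      by rewrite d'E => /In_filter[].
    have /In_map[j' [jj' j'd]] : In (sval j) (map sval d').
      by rewrite d'E; apply/In_filter; split=> //; case: (j).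
    by rewrite -(sval_bool_inj jj').
  rewrite (size_sub _ _ Aa) (size_sub _ _ Bb).
  have xss : StronglySorted (wlt x) (i :: s) by move: xs => /(Enum_ssorted wx)[].
  have := congr1 size (split3 _ xss); rewrite !size_cat.
  (* The letter [i] lies in neither [A] nor [B], so fewer letters of index below [m] remain. *)
  have : 0 < size [seq j <- i :: s | `[< j = i >]].
    by rewrite /= (asboolT (erefl i)).
  by move: sn; set p := size (filter _ _); set q := size (filter _ _);
     set r := size (filter _ _); lia.
have NI : InN I.
  apply: InN_fin => //; have ii : `[< i = i >] by apply/asboolP.
  exists [:: exist _ i ii] => -[j ji]; left; apply: sval_bool_inj.
  exact: esym (asboolW ji).
apply: (InN_equiv _ _ (InN_mul _ _ (InN_conj _ _ wA NI) NAB) wx).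
apply/wequivP => // [|k]; first by do !apply: IsWord_concat.
rewrite !proj_concat //; last exact: IsWord_concat.
rewrite projABI proj_inv // -!catA; apply: feq_cat => //; apply: feq_cat => //.
by rewrite catA feq_Vcat.
Qed.

(** Replaces the inductively defined normal closure by a condition on finite words, the form in
    which [aeq] is handled below. *)
Lemma aeqP x y : IsWord x -> IsWord y ->
  aeq x y <-> exists m, forall k, tail m (proj x k) ≈ tail m (proj y k).
Proof.
move=> wx wy; have wiy := IsWord_inv wy; have wxy := IsWord_concat wx wiy.
have E m k : tail m (proj (wconcat x (winv y)) k) ≈ [::] <->
    tail m (proj x k) ≈ tail m (proj y k).
  by rewrite proj_concat // proj_inv // tail_cat tail_finv -feq_catVP.
split=> [/InN_atriv[_ [m xm]]|[m xm]]; first by exists m => k; apply/E.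
by apply: atriv_InN => //; exists m => k; apply/E.
Qed.

(** * Infinite products *)

Lemma aeq_proj x y : IsWord x -> IsWord y -> (forall k, proj x k ≈ proj y k) -> aeq x y.
Proof. by move=> wx wy xy; apply/aeqP => //; exists 0 => k; apply/tail_feq/xy. Qed.

Lemma aeq_refl x : IsWord x -> aeq x x.
Proof. by move=> wx; apply: aeq_proj. Qed.

Lemma aeq_sym x y : IsWord x -> IsWord y -> aeq x y -> aeq y x.
Proof.
by move=> wx wy /(aeqP wx wy)[m xy]; apply/(aeqP wy wx); exists m => k; rewrite xy.
Qed.

Lemma aeq_tails x y m n : (forall k, tail m (proj x k) ≈ tail m (proj y k)) ->
  m <= n -> forall k, tail n (proj x k) ≈ tail n (proj y k).
Proof.
move=> xy mn k; rewrite -(tail_widen (proj x k) mn) -(tail_widen (proj y k) mn).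
exact/tail_feq/xy.
Qed.

Lemma aeq_trans x y z : IsWord x -> IsWord y -> IsWord z ->
  aeq x y -> aeq y z -> aeq x z.
Proof.
move=> wx wy wz /(aeqP wx wy)[m xy] /(aeqP wy wz)[n yz]; apply/(aeqP wx wz).
exists (maxn m n) => k.
by rewrite (aeq_tails xy (leq_maxl _ _)) (aeq_tails yz (leq_maxr _ _)).
Qed.

Lemma aeq_concat x x' y y' : IsWord x -> IsWord x' -> IsWord y -> IsWord y' ->
  aeq x x' -> aeq y y' -> aeq (wconcat x y) (wconcat x' y').
Proof.
move=> wx wx' wy wy' /(aeqP wx wx')[m xx'] /(aeqP wy wy')[n yy'].
apply/aeqP; [exact: IsWord_concat..|].
exists (maxn m n) => k; rewrite !proj_concat // !tail_cat.
by rewrite (aeq_tails xx' (leq_maxl _ _)) (aeq_tails yy' (leq_maxr _ _)).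
Qed.

Section IteratedProduct.
Variables (x : nat -> rawword) (mult : nat -> nat).

(* Positions in the infinite word [y n = x n * (y n.+1) ^ mult n]. *)
Inductive position (n : nat) : Type :=
  | Here (i : carrier (x n))
  | Down (d : 'I_(mult n)) (t : position n.+1).
Arguments Here {n} i.
Arguments Down {n} d t.

Fixpoint position_lt n (t : position n) : position n -> Prop :=
  match t with
  | Here i => fun u => if u is Here j then wlt (x n) i j else True
  | Down d t' => fun u =>
      if u is Down e u' then d < e \/ d = e /\ position_lt t' u' else False
  end.

Fixpoint position_letter n (t : position n) : nat * Z :=
  match t with
  | Here i => letter (x n) i
  | Down _ t' => position_letter t'
  end.

Definition iprod n := RawWord (position n) (@position_lt n) (@position_letter n).

Hypothesis wx : forall n, IsWord (x n).
Hypothesis x_ge : forall n i, n <= fst (letter (x n) i).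

Lemma position_letter_ge n (t : position n) : n <= fst (position_letter t).
Proof. by elim: t => {n} [n i|n d t /ltnW] //=; apply: x_ge. Qed.

Lemma IsWord_iprod n : IsWord (iprod n).
Proof.
split.
  elim=> {n} [n i|n d t IH] /=; first by case: (wx n) => irr _; apply: irr.
  by case=> [|[]//]; rewrite ltnn.
split.
  elim=> {n} [n i|n d t IH] [j|e u] [l|c v] //=.
    by case: (wx n) => _ [+ _]; apply.
  move=> [de|[-> tu]] [ec|[<- uv]]; [left|left|left|right] => //.
    exact: ltn_trans ec.
  by split=> //; apply: IH uv.
split.
  elim=> {n} [n i|n d t IH] [j|e u] /=; [|by left|by right; right|].
    by case: (wx n) => _ [_ [+ _]] => /(_ i j) [?|[->|?]];
      [left|right; left|right; right].
  have [de|ed|de] := ltngtP d e; [by left; left|by right; right; left|].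
  have {}de := val_inj de; subst e.
  by have [?|[->|?]] := IH u; [left; right|right; left|right; right; right].
split.
  have [f f_inj] : exists f : forall n, carrier (x n) -> nat, forall n, injective (f n).
    have wf n' : {f : carrier (x n') -> nat | injective f}.
      by apply: cid; case: (wx n') => _ [_ [_ [[f fP] _]]]; exists f => i j /fP.
    by exists (fun n' => sval (wf n')) => n'; case: (wf n').
  (* Parity separates the two constructors; [pickle] pairs the copy with the code of the remaining
     path. *)
  pose code := fix code n (t : position n) : nat :=
    match t with
    | Here i => (f n i).*2
    | Down d t' => (pickle (val d, code n.+1 t')).*2.+1
    end.
  exists (code n) => i j.
  elim: i j => {n} [n i|n d t IH] [j|e u] /=; try lia.
    by move/double_inj/f_inj ->.
  move=> [/double_inj/(pcan_inj pickleK) [/val_inj -> /IH ->]] //.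
split; first by elim=> {n} [n i|n d t IH] //=; case: (wx n) => _ [_ [_ [_ []]]].
(* By [x_ge], letters of index [m] come only from levels up to [m], so the descent stops once [n]
   exceeds [m]. *)
move=> m; have [j] := ubnP (m.+1 - n); elim: j n => // j IH n mn.
have [mln|nm] := ltnP m n.
  exists [::] => t tm; have := position_letter_ge t.
  by rewrite -[letter _ _]/(position_letter t) in tm; lia.
have [|l lP] := IH n.+1; first by lia.
have [_ [_ [_ [_ [_ /(_ m)[lx lxP]]]]]] := wx n.
exists (map Here lx ++ flatten [seq map (Down d) l | d <- enum 'I_(mult n)]).
case=> [i|d t] /= E; apply/In_cat; [left|right].
  by apply/In_map; exists i; split=> //; apply: lxP.
have : d \in enum 'I_(mult n) by rewrite mem_enum.
elim: (enum _) => //= e D IHD; rewrite inE In_cat => /orP[/eqP <-|/IHD]; [left|by right].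
by apply/In_map; exists t; split=> //; apply: lP.
Qed.

Lemma Enum_iprod n m a b : Enum (x n) m a -> Enum (iprod n.+1) m b ->
  Enum (iprod n) m (map Here a ++ flatten [seq map (Down d) b | d <- enum 'I_(mult n)]).
Proof.
move=> /(Enum_ssorted (wx n))[sa aP] /(Enum_ssorted (IsWord_iprod n.+1))[sb bP].
have In_down D t : In t (flatten [seq map (@Down n d) b | d <- D]) <->
    exists d u, [/\ d \in D, In u b & t = Down d u].
  elim: D => [|d D IH] /=; first by split=> // -[? [? []]].
  rewrite In_cat In_map IH; split.
    move=> [[u [<- ub]]|[e [u [eD ub ->]]]]; first by exists d, u; rewrite mem_head.
    by exists e, u; rewrite inE eD orbT.
  move=> [e [u []]]; rewrite inE => /orP[/eqP ->|eD] ub ->; first by left; exists u.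
  by right; exists e, u.
apply/(Enum_ssorted (IsWord_iprod n)); split.
  apply/ssorted_cat; split; first exact/ssorted_map.
    have : StronglySorted (fun d e : 'I_(mult n) => d < e) (enum 'I_(mult n)).
      apply/(ssorted_map (fun d e => d < e) val); rewrite val_enum_ord.
      elim: (mult n) 0 => [|l IH] o; first by constructor.
      apply/ssorted_cons; split=> // y /In_mem.
      by rewrite mem_iota => /andP[].
    elim: (enum _) => [|d D IH] /=; first by constructor.
    move=> /ssorted_cons[sD dD]; apply/ssorted_cat; split; last 1 first.
    - move=> t u /In_map[t' [<- _]] /In_down[e [u' [eD _ ->]]]; left.
      exact/dD/In_mem.
    - apply/ssorted_map; apply: ssorted_impl sb => t u tu; by right.
    - exact: IH.
  by move=> t u /In_map[i [<- _]] /In_down[d [u' [_ _ ->]]].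
case=> [i|d t]; rewrite In_cat In_down /=.
  rewrite -aP; split=> [[/In_map[j [[<-]]]|[d [u []]]]|ia] //.
  by left; apply/In_map; exists i.
rewrite -[_ < m]/(fst (letter (iprod n.+1) t) < m) -bP; split.
  by move=> [/In_map[j []]|[e [u [_ ub [_ ->]]]]].
by move=> tb; right; exists d, t; rewrite mem_enum.
Qed.

Lemma proj_iprod n m :
  proj (iprod n) m = proj (x n) m ++ flatten (nseq (mult n) (proj (iprod n.+1) m)).
Proof.
have [a xa] := Enum_ex (wx n) m; have [b xb] := Enum_ex (IsWord_iprod n.+1) m.
rewrite (projE (IsWord_iprod n) (Enum_iprod xa xb)) (projE (wx n) xa).
rewrite (projE (IsWord_iprod n.+1) xb) map_cat expand_cat -map_comp; congr (_ ++ _).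
rewrite -[in RHS](size_enum_ord (mult n)); elim: (enum _) => //= d D IH.
by rewrite map_cat expand_cat IH -map_comp.
Qed.

Lemma proj_iprod_nil n m : m <= n -> proj (iprod n) m = [::].
Proof.
move=> mn; have E : Enum (iprod n) m [::].
  apply/(Enum_ssorted (IsWord_iprod n)); split; first by constructor.
  move=> t; split=> // tm; have := position_letter_ge t.
  by rewrite leqNgt (leq_trans tm).
by rewrite (projE (IsWord_iprod n) E).
Qed.

End IteratedProduct.

(** * Integer powers and exponent sums *)

Section IntegerPowers.
Import GRing.Theory.
Local Open Scope ring_scope.

Definition lpow (T : Type) (u : seq (T * bool)) (z : int) : seq (T * bool) :=
  match z with
  | Posz k => flatten (nseq k u)
  | Negz k => flatten (nseq k.+1 (finv u))
  end.

Lemma flatten_nseq_last (T : Type) k (u : seq T) :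
  flatten (nseq k.+1 u) = flatten (nseq k u) ++ u.
Proof. elim: k => [|k IH]; first by rewrite /= cats0.
by rewrite -[LHS]/(u ++ flatten (nseq k.+1 u)) {1}IH catA. Qed.

Lemma lpow_succ (T : eqType) (u : seq (T * bool)) z : lpow u (z + 1) ≈ lpow u z ++ u.
Proof.
case: z => k.
  by rewrite -PoszD addn1 -flatten_nseq_last.
rewrite [in X in _ ≈ X]/lpow flatten_nseq_last -catA feq_Vcat cats0.
have -> : Negz k + 1 = - k%:Z by rewrite NegzE; lia.
by case: k => // k; rewrite -NegzE.
Qed.

Lemma lpow_add (T : eqType) (u : seq (T * bool)) a b :
  lpow u (a + b) ≈ lpow u a ++ lpow u b.
Proof.
elim/int_ind: b => [|n IH|n IH]; first by rewrite addr0 cats0.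
  by rewrite -addn1 PoszD addrA !lpow_succ IH catA.
have lpow_pred z : lpow u (z - 1) ≈ lpow u z ++ finv u.
  by rewrite -{2}(subrK 1 z) lpow_succ -catA feq_catV cats0.
have -> : a - (n.+1)%:Z = (a - n%:Z) - 1 by lia.
have -> : - (n.+1)%:Z = - n%:Z - 1 by lia.
by rewrite !lpow_pred IH catA.
Qed.

Lemma lpow_mul (T : eqType) (u : seq (T * bool)) (c : nat) z :
  lpow (flatten (nseq c u)) z ≈ lpow u (z * c%:Z).
Proof.
elim/int_ind: z => [|n IH|n IH].
- by rewrite mul0r.
- have -> : (n.+1)%:Z * c%:Z = n%:Z * c%:Z + c%:Z by lia.
  by rewrite lpow_add -IH -addn1 PoszD lpow_succ.
- have -> : - (n.+1)%:Z * c%:Z = - n%:Z * c%:Z + (- c%:Z) by lia.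
  have -> : - (n.+1)%:Z = - n%:Z + (- 1%:Z) by lia.
  rewrite !lpow_add IH; apply: feq_cat => //.
  rewrite -[lpow _ (- 1%:Z)]/(finv (flatten (nseq c u)) ++ [::]) cats0.
  case: c {IH} => // c; rewrite -NegzE.
  suff -> : finv (flatten (nseq c.+1 u)) = flatten (nseq c.+1 (finv u)) by [].
  elim: c.+1 => // k IHk.
  by rewrite flatten_nseq_last finv_cat IHk.
Qed.

(** The exponent sum of the generator [j]. *)
Definition esum (j : nat) (u : seq (nat * bool)) : int :=
  foldr (fun a s => (if a.1 == j then (if a.2 then 1 else -1) else 0) + s) 0 u.

Lemma esum_feq j u v : u ≈ v -> esum j u = esum j v.
Proof.
move=> uv; have H w : esum j w = esum j (fred w).
  rewrite /esum (@foldr_fred _ _ _ (fun=> True)) //.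
  by case=> n [] s _ /=; case: eqP => _; ring.
by rewrite H uv -H.
Qed.

Lemma esum_cat j u v : esum j (u ++ v) = esum j u + esum j v.
Proof. by elim: u => [|a u /= ->]; rewrite ?add0r ?addrA. Qed.

Lemma esum_lpow j u z : esum j (lpow u z) = z * esum j u.
Proof.
have E n : esum j (lpow u n%:Z) = n%:Z * esum j u.
  elim: n => [|n IH]; first by rewrite mul0r.
  by rewrite /= esum_cat [esum j (flatten _)]IH; lia.
case: z => n; first exact: E.
have := E n.+1; rewrite NegzE => En.
have : esum j (lpow u (- n.+1%:Z) ++ lpow u n.+1%:Z) = 0.
  by rewrite -(@esum_feq j [::]) // -lpow_add addNr.
by rewrite esum_cat En; lia.
Qed.

Lemma esum_tail j m u : (m <= j)%N -> esum j (tail m u) = esum j u.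
Proof.
move=> mj; elim: u => // -[n b] u /= IH; case: ifP => /= h; rewrite IH //.
by case: eqP => [nj|_]; rewrite ?add0r //; move: h; rewrite nj mj.
Qed.

Definition wpow (w : rawword) (k : nat) : rawword := iter k (wconcat w) wempty.
Definition zpow (w : rawword) (z : int) : rawword :=
  match z with Posz k => wpow w k | Negz k => wpow (winv w) k.+1 end.

Lemma IsWord_zpow w z : IsWord w -> IsWord (zpow w z).
Proof.
have E v k : IsWord v -> IsWord (wpow v k).
  by move=> wv; elim: k => [|k]; [exact: IsWord_empty|apply: IsWord_concat].
by move=> ww; case: z => k; apply: E => //; apply: IsWord_inv.
Qed.

Lemma proj_zpow w z m : IsWord w -> proj (zpow w z) m = lpow (proj w m) z.
Proof.
have E v k : IsWord v -> proj (wpow v k) m = flatten (nseq k (proj v m)).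
  move=> wv; elim: k => [|k IH]; first exact: proj_empty.
  rewrite [wpow _ _]/(wconcat v (wpow v k)) proj_concat ?IH //.
  exact: (IsWord_zpow k).
move=> ww; case: z => k; rewrite E // ?proj_inv //; exact: IsWord_inv.
Qed.

Lemma aeq_zpow v w z : IsWord v -> IsWord w -> aeq v w -> aeq (zpow v z) (zpow w z).
Proof.
move=> wv ww /(aeqP wv ww)[m vw].
apply/(aeqP (IsWord_zpow z wv) (IsWord_zpow z ww)); exists m => k.
rewrite !proj_zpow //.
have E u n : tail m (flatten (nseq n u)) = flatten (nseq n (tail m u)).
  by elim: n => //= n IH; rewrite tail_cat IH.
have F (u u' : seq (nat * bool)) n : u ≈ u' -> flatten (nseq n u) ≈ flatten (nseq n u').
  by move=> uu'; elim: n => // n IH; apply: feq_cat.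
case: z => n; rewrite /lpow !E; apply: F; rewrite ?tail_finv ?vw //.
Qed.

End IntegerPowers.

(** * The copy of Q *)

Section RationalSubgroup.
Import GRing.Theory Num.Theory.
Local Open Scope ring_scope.

Definition single (n : nat) : rawword :=
  RawWord unit (fun _ _ => False) (fun=> (n, 1%coqZ)).

Lemma IsWord_single n : IsWord (single n).
Proof.
do 2 (split; first by move=> *; auto).
split; first by move=> [] []; right; left.
split; first by exists (fun=> 0%N) => -[] [].
by split=> // m; exists [:: tt] => -[]; left.
Qed.

Lemma proj_single n k : proj (single n) k = if (n < k)%N then [:: (n, true)] else [::].
Proof.
have ws := IsWord_single n; case: ifP => nk.
  have E : Enum (single n) k [:: tt].
    apply/(Enum_ssorted ws); split; first by apply/ssorted_cons; split=> //; constructor.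
    by case; split=> // _; left.
  by rewrite (projE ws E).
have E : Enum (single n) k [::].
  apply/(Enum_ssorted ws); split; first by constructor.
  by case; split=> //=; rewrite nk.
by rewrite (projE ws E).
Qed.

(* In A(Z), where the letters [single n] vanish, [rat_root n = (rat_root n.+1) ^ (n + 2)];
   so [rat_root n] plays the role of [1 / (n + 1)!]. *)
Definition rat_root n := iprod single (fun n => n.+2) n.

Lemma IsWord_rat_root n : IsWord (rat_root n).
Proof. by apply: IsWord_iprod => [m|m i]; [exact: IsWord_single|]. Qed.

Lemma proj_rat_root n m :
  proj (rat_root n) m = proj (single n) m ++ flatten (nseq n.+2 (proj (rat_root n.+1) m)).
Proof. by apply: proj_iprod => [k|k i]; [exact: IsWord_single|]. Qed.

Lemma aeq_rat_root n : aeq (rat_root n) (zpow (rat_root n.+1) n.+2).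
Proof.
have wn := IsWord_rat_root n; have wn1 := IsWord_rat_root n.+1.
apply/(aeqP wn (IsWord_zpow _ wn1)); exists n.+1 => k.
rewrite proj_rat_root proj_zpow // tail_cat proj_single.
by case: ifP => //= _; rewrite ltnn.
Qed.

(** The sum is (M + 2)(M + 3)...(j + 1): level n contributes the factor n + 2 until the single
    letter [j] is reached, and projecting to indices below j + 1 ends the recursion there. *)
Lemma esum_rat_root_gt0 M j : (M <= j)%N -> 0 < esum j (proj (rat_root M) j.+1).
Proof.
move=> Mj; have [d] := ubnP (j - M); elim: d M Mj => // d IH M Mj dM.
rewrite proj_rat_root proj_single ltnS Mj esum_cat.
rewrite -[flatten _]/(lpow (proj (rat_root M.+1) j.+1) M.+2) esum_lpow.
have [Mj'|jM] := ltnP M j.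
  have := IH M.+1 Mj'; rewrite /= ltn_eqF // => H.
  have {H} : 0 < esum j (proj (rat_root M.+1) j.+1) by apply: H; lia.
  by move=> ?; rewrite !add0r mulr_gt0.
have -> : M = j by lia.
have -> : proj (rat_root j.+1) j.+1 = [::].
  by apply: proj_iprod_nil => [k|k i|]; [exact: IsWord_single| |].
by rewrite /= eqxx mulr0 !addr0.
Qed.

(** A generator [j] of index at least [m] survives in the tail, and at least [N] it has nonzero
    exponent sum in the root, which recovers the exponent. *)
Lemma zpow_rat_root_inj N z z' : aeq (zpow (rat_root N) z) (zpow (rat_root N) z') -> z = z'.
Proof.
have wN := IsWord_rat_root N.
move=> /(aeqP (IsWord_zpow z wN) (IsWord_zpow z' wN))[m E].
pose j := maxn m N; have := esum_feq j (E j.+1).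
rewrite !esum_tail ?leq_maxl // !proj_zpow // !esum_lpow.
have := esum_rat_root_gt0 (leq_maxr m N); rewrite -/j => e0.
exact/mulIf/lt0r_neq0.
Qed.

(** Thus [a] = z / (N + 1)!, to be sent to the power [z] of [rat_root N]. *)
Definition represents (a : rat) N (z : int) := z%:~R = a * (N.+1)`!%:R.

Lemma represents_ex a : exists Nz, represents a Nz.1 Nz.2.
Proof.
set d := `|denq a|%N; have d0 : (0 < d)%N by rewrite absz_gt0 denq_neq0.
have aE : a = (numq a)%:~R / d%:R by rewrite -{1}(divq_num_den a) -absz_denq.
have dv : (d %| (d.+1)`!)%N by rewrite dvdn_fact // d0 /=.
(* The denominator itself serves as the level, as [d] divides (d + 1)!. *)
exists (d, numq a * ((d.+1)`! %/ d)%N%:Z).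
rewrite /represents /= intrM [X in _ = X * _]aE -mulrA; congr (_ * _).
rewrite -[in RHS](divnK dv) natrM mulrCA mulVf ?mulr1 //.
by rewrite pnatr_eq0 -lt0n.
Qed.

Lemma represents_lift a N z M : (N <= M)%N -> represents a N z ->
  exists z', represents a M z' /\ aeq (zpow (rat_root N) z) (zpow (rat_root M) z').
Proof.
move=> NM rN; have wr := IsWord_rat_root.
rewrite -(subnK NM); elim: (M - N)%N => [|k [z' [rz E]]].
  by exists z; split=> //; apply/aeq_refl/IsWord_zpow.
(* Passing to the next root multiplies the exponent by k + N + 2, the quotient of the two
   factorials. *)
exists (z' * (k + N).+2); split.
  by rewrite /represents intrM rz addSn [((_).+2)`!]factS natrM; ring.
have w1 := IsWord_zpow (k + N).+2 (wr (k + N).+1).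
apply: aeq_trans E _; try exact: IsWord_zpow.
apply: aeq_trans (aeq_zpow z' (wr _) w1 (aeq_rat_root _)) _; try exact: IsWord_zpow.
apply: aeq_proj; try exact: IsWord_zpow.
by move=> m; rewrite !proj_zpow // lpow_mul.
Qed.

(** Each rational gets an arbitrary representing pair; lifting to a common level [M] reduces
    additivity and injectivity to integer exponents. *)
Lemma rat_embeds : exists f : rat -> rawword,
  (forall q, IsWord (f q)) /\
  (forall a b, aeq (f (a + b)) (wconcat (f a) (f b))) /\
  (forall a b, aeq (f a) (f b) -> a = b).
Proof.
have [s sP] := choice represents_ex; have wr := IsWord_rat_root.
pose f a := zpow (rat_root (s a).1) (s a).2.
have wf a : IsWord (f a) by apply: IsWord_zpow.
have fM a M : ((s a).1 <= M)%N ->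
    exists z, represents a M z /\ aeq (f a) (zpow (rat_root M) z).
  by move=> aM; apply: represents_lift.
have fact_neq0 M : (M.+1)`!%:R != 0 :> rat by rewrite pnatr_eq0 -lt0n fact_gt0.
exists f; split=> //; split=> a b.
  pose M := ((s a).1 + (s b).1 + (s (a + b)%R).1)%N.
  have [|za [ra Ea]] := fM a M; first by rewrite /M; lia.
  have [|zb [rb Eb]] := fM b M; first by rewrite /M; lia.
  have [|zc [rc Ec]] := fM (a + b) M; first by rewrite /M; lia.
  have zE : zc = za + zb.
    by apply: (@intr_inj rat); rewrite intrD ra rb rc mulrDl.
  have wz z : IsWord (zpow (rat_root M) z) by apply: IsWord_zpow.
  have wab : IsWord (wconcat (f a) (f b)) by apply: IsWord_concat.
  have wz2 : IsWord (wconcat (zpow (rat_root M) za) (zpow (rat_root M) zb)) by apply: IsWord_concat.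
  apply: aeq_trans Ec _ => //.
  apply: aeq_trans (aeq_sym wab wz2 (aeq_concat _ _ _ _ Ea Eb)) => //.
  by apply: aeq_proj => // k; rewrite proj_concat // !proj_zpow // zE lpow_add.
move=> ab; pose M := ((s a).1 + (s b).1)%N.
have [|za [ra Ea]] := fM a M; first by rewrite /M; lia.
have [|zb [rb Eb]] := fM b M; first by rewrite /M; lia.
have wz z : IsWord (zpow (rat_root M) z) by apply: IsWord_zpow.
have zz : za = zb.
  apply: (@zpow_rat_root_inj M); apply: aeq_trans Eb => //.
  by apply: aeq_trans ab => //; apply: aeq_sym.
by apply: (mulIf (fact_neq0 M)); rewrite -ra -rb zz.
Qed.

End RationalSubgroup.

(* For [x] with [h x = 1] and [y n = x_n * (y n.+1) ^ 3], where [x_n] is [x] without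
   its letters of index [< n], [2 h (y n) + 1 = 3 (2 h (y n.+1) + 1)]; so the odd
   number [2 h (y 0) + 1] is divisible by every power of 3. *)
Lemma not_indicable : ~ exists h : rawword -> Z,
  (forall x y, IsWord x -> IsWord y -> aeq x y -> h x = h y) /\
  (forall x y, IsWord x -> IsWord y -> h (wconcat x y) = Z.add (h x) (h y)) /\
  (forall z : Z, exists x, IsWord x /\ h x = z).
Proof.
move=> [h [h_aeq [hM /(_ 1%coqZ)[x [wx hx]]]]].
pose X n := @subword x (fun i => n <= fst (letter x i)).
have wX n : IsWord (X n) by apply: IsWord_sub.
have X_ge n i : n <= fst (letter (X n) i) by case: i.
(* Only letters of index below [n] are removed, so [X n] and [x] agree in A(Z). *)
have hX n : h (X n) = 1%coqZ.
  rewrite -hx; apply: h_aeq => //; apply/aeqP => //; exists n => k.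
  have [s xs] := Enum_ex wx k; rewrite (proj_sub _ wx xs) (projE wx xs).
  rewrite /tail !(filter_expand (fun l => n <= l)) filter_map filter_map -filter_predI.
  by rewrite (eq_filter (a2 := fun i => n <= fst (letter x i))) // => i /=; rewrite andbb.
pose Y := iprod X (fun=> 3).
have wY n : IsWord (Y n) by apply: IsWord_iprod.
have hY n : h (Y n) = (1 + 3 * h (Y n.+1))%coqZ.
  have w2 := IsWord_concat (wY n.+1) (wY n.+1).
  have w3 := IsWord_concat (wY n.+1) w2.
  rewrite (h_aeq _ (wconcat (X n) (wconcat (Y n.+1) (wconcat (Y n.+1) (Y n.+1))))) //.
  - by rewrite !hM // hX; lia.
  - exact: IsWord_concat.
  apply: aeq_proj => // [|k]; first exact: IsWord_concat.
  by rewrite proj_iprod // !proj_concat //= cats0.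
(* Infinite descent: the odd number is nonzero, so its absolute value drops strictly when [n]
   increases. *)
have [N] := ubnP (Z.abs_nat (2 * h (Y 0) + 1)).
elim: N 0 => // N IH n lt; apply: (IH n.+1).
move: lt (hY n); lia.
Qed.

(** * Local freeness *)

Section LocallyFree.

Definition realize (I : Type) (g : I -> rawword) (u : seq (I * bool)) : rawword :=
  foldr (fun a w => wconcat (sgen (g a.1, a.2)) w) wempty u.

Lemma IsWord_realize (I : Type) (g : I -> rawword) u :
  (forall i, IsWord (g i)) -> IsWord (realize g u).
Proof.
move=> wg; elim: u => [|[i b] u IH]; first exact: IsWord_empty.
by apply: IsWord_concat => //; rewrite /sgen /=; case: b => //; apply: IsWord_inv.
Qed.

Lemma proj_realize (I : Type) (g : I -> rawword) u k : (forall i, IsWord (g i)) ->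
  proj (realize g u) k = fsub (fun i => proj (g i) k) u.
Proof.
move=> wg; elim: u => [|[i b] u IH]; first exact: proj_empty.
have wi := IsWord_inv (wg i).
rewrite [realize _ _]/(wconcat (sgen (g i, b)) (realize g u)) proj_concat.
- by rewrite IH fsub_cons; case: b; rewrite /sgen /lsub //= proj_inv.
- by rewrite /sgen /=; case: b.
- exact: IsWord_realize.
Qed.

Lemma Gen_realize (P : rawword -> Prop) (I : Type) (g : I -> rawword) u :
  (forall i, Gen P (g i)) -> Gen P (realize g u).
Proof.
move=> Pg; elim: u => [|[i b] u IH]; first exact: Gen_one.
by apply: Gen_mul => //; rewrite /sgen /=; case: b => //; apply: Gen_inv.
Qed.

Lemma tail_fsub (I : Type) m (g : I -> seq (nat * bool)) u :
  tail m (fsub g u) = fsub (fun i => tail m (g i)) u.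
Proof.
elim: u => // a u IH; rewrite !fsub_cons tail_cat IH; congr (_ ++ _).
by rewrite /lsub; case: a.2; rewrite ?tail_finv.
Qed.

Lemma In_nth (A : Type) (d : A) s x : In x s <-> exists i, i < size s /\ nth d s i = x.
Proof.
elim: s => [|y s IH] /=; first by split=> // -[? []].
rewrite IH; split=> [[<-|[i [si <-]]]|[[|i] [si <-]]].
- by exists 0.
- by exists i.+1.
- by left.
- by right; exists i.
Qed.

(** Opposite neighbours in [u] carry the same word with opposite signs, which [reduced_bw] forbids
    by reflexivity of [aeq]. *)
Lemma freduced_basis_word (I : eqType) (g : I -> rawword) (u : seq (I * bool)) :
  (forall i, IsWord (g i)) -> reduced_bw [seq (g a.1, a.2) | a <- u] -> freduced u.
Proof.
move=> wg; rewrite /freduced; elim: u => // a [|c u] IH //= [nac red].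
apply/andP; split; last exact: IH.
by apply/eqP => ca; apply: nac; rewrite ca; split=> //; apply: aeq_refl.
Qed.

Lemma locally_free (gs : seq rawword) : (forall g, In g gs -> IsWord g) ->
  FreeSubgroup (fun x => IsWord x /\ Gen (fun g => In g gs) x).
Proof.
move=> wgs; pose T : finType := 'I_(size gs).
pose g (i : T) := nth wempty gs i.
have gs_g i : In (g i) gs by apply/(In_nth wempty); exists i.
have wg i : IsWord (g i) by apply: wgs.
have wR u := IsWord_realize u wg.
pose f m k (i : T) := tail m (proj (g i) k).
have fE m k u : fsub (f m k) u = tail m (proj (realize g u) k).
  by rewrite proj_realize // tail_fsub.
(* The kernel of [f m k] shrinks with [k] and grows with [m], both by deletion of letters. The
   resulting [p] has the same kernel as the map from the free group on [T] to A(Z). *)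
have [| |p pP] := @fker_double_limit T _ f.
- move=> m k w; rewrite /fker !fE => /(feq_filter (fun n => n < k)).
  rewrite /tail -filter_predI (proj_widen (wR w) (leqnSn k)) -filter_predI.
  by congr (_ ≈ _); apply: eq_filter => a /=; rewrite andbC.
- by move=> m k w; rewrite /fker !fE => /(tail_feq m.+1); rewrite tail_widen.
have aeq_p u w : aeq (realize g u) (realize g w) <-> fsub p u ≈ fsub p w.
  rewrite aeqP // -fkerP -pP; split=> -[m E]; exists m => k; move: (E k);
    by rewrite fkerP !fE.
(* The image of [p] is isomorphic to the subgroup generated by [gs], so a basis of it gives the
   words [realize g (v i)]. *)
have [I [v [v_free v_gen]]] := nielsen_schreier p.
have [V VP] := choice v_gen.
have wv i : IsWord (realize g (v i)) by [].
have realize_v U k : proj (realize (fun i => realize g (v i)) U) k =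
    proj (realize g (fsub v U)) k.
  rewrite !proj_realize // fsub_comp; apply: eq_fsub => i; exact: proj_realize.
have wRv U := IsWord_realize U wv.
exists (fun b => exists i, b = realize g (v i)); split; [|split].
- move=> _ [i ->]; split=> //; split=> //; apply: Gen_realize => i'.
  exact: Gen_base.
- move=> x [_ gx].
  have [wx [u ux]] : IsWord x /\ exists u, aeq (realize g u) x.
    elim: gx => {x} [x xgs||x _ [wx [u ux]]|x y _ [wx [u ux]] _ [wy [w wy']]
                    |x y _ [wx [u ux]] wy xy].
    + have wx := wgs _ xgs; split=> //.
      have [i [si xi]] := (In_nth wempty gs x).1 xgs; exists [:: (Ordinal si, true)].
      apply: aeq_proj => // k; rewrite proj_realize // fsub1 /lsub /=.
      by rewrite /g xi.
    + by split; [exact: IsWord_empty|exists [::]; apply/aeq_refl/IsWord_empty].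
    + have wix := IsWord_inv wx; split=> //; exists (finv u).
      move/(aeqP (wR u) wx): ux => [m ux]; apply/(aeqP (wR _) wix); exists m => k.
      by rewrite -fE fsub_finv fE proj_inv // tail_finv ux.
    + have wxy := IsWord_concat wx wy; split=> //; exists (u ++ w).
      apply: aeq_trans (aeq_concat (wR u) wx (wR w) wy ux wy') => //.
        exact: IsWord_concat.
      apply: aeq_proj => //; first exact: IsWord_concat.
      by move=> k; rewrite proj_concat // !proj_realize // fsub_cat.
    + by split=> //; exists u; apply: aeq_trans xy.
  (* [V] expresses the generators in the basis, so [fsub V u] spells [x] in basis elements. *)
  apply: (@Gen_equiv _ (realize (fun i => realize g (v i)) (fsub V u))) => //.
    by apply: Gen_realize => i; apply: Gen_base; exists i.
  apply: aeq_trans ux => //.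
  apply: (@aeq_trans _ (realize g (fsub v (fsub V u)))) => //.
    by apply: aeq_proj => // k; rewrite realize_v.
  apply/aeq_p; rewrite !fsub_comp; symmetry.
  have := @fsub_feqf _ _ p (fun i => fsub p (fsub v (V i))) u VP.
  by rewrite /feq => ->; congr fred; apply: eq_fsub => i; rewrite fsub_comp.
- move=> l l0 lB red E.
  (* Basis elements are given as words; an index is chosen for each so that [v_free] applies. *)
  have [U lU] : exists U : seq (I * bool), l = [seq (realize g (v a.1), a.2) | a <- U].
    elim: l lB {l0 red E} => [|[b e] l IH] lB; first by exists [::].
    have [i bi] := lB _ (or_introl erefl).
    have [|U ->] := IH; first by move=> q ql; apply: lB; right.
    by exists ((i, e) :: U); rewrite /= -bi.
  subst l; have rU := freduced_basis_word wv red.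
  have {}E : aeq (realize (fun i => realize g (v i)) U) wempty.
    move: E; congr aeq; rewrite /eval_basis_word.
    by elim: (U) => //= a U' ->.
  have : fsub p (fsub v U) ≈ fsub p [::].
    apply/aeq_p; apply: aeq_trans E => //; first exact: IsWord_empty.
    by apply: aeq_proj => // k; rewrite realize_v.
  move=> /v_free; rewrite /feq fred_id // => U0.
  by apply: l0; rewrite U0.
Qed.

End LocallyFree.

Theorem theoremB :
  (* (1) Q embeds into A(Z) as a subgroup *)
  (exists f : rat -> rawword,
      (forall q, IsWord (f q)) /\
      (forall a b, aeq (f (a + b)%R) (wconcat (f a) (f b))) /\
      (forall a b, aeq (f a) (f b) -> a = b)) /\
  (* (2) A(Z) has no infinite cyclic quotient *)
  (~ exists h : rawword -> Z,
      (forall x y, IsWord x -> IsWord y -> aeq x y -> h x = h y) /\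
      (forall x y, IsWord x -> IsWord y -> h (wconcat x y) = Z.add (h x) (h y)) /\
      (forall z : Z, exists x, IsWord x /\ h x = z)) /\
  (* (3) A(Z) is locally free *)
  (forall gs : list rawword, (forall g, In g gs -> IsWord g) ->
      FreeSubgroup (fun x => IsWord x /\ Gen (fun g => In g gs) x)).
Proof.
split; first exact: rat_embeds.
split; [exact: not_indicable|exact: locally_free].
Qed.
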